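(* Fix $s\in(1/2,1)$ and let $\Omega\subset\mathbb{R}^N$ be a bounded $C^2$ domain. Consider either one of the two Dirichlet problems: the trace problem $$-\sum_{i=1}^N\Lambda_i^s u(x)=0\ \ (x\in\Omega),\qquad u(x)=g(x)\ \ (x\in\mathbb{R}^N\setminus\Omega),$$ or the mid-range problem $$\Lambda_1^s u(x)+\Lambda_N^s u(x)=0\ \ (x\in\Omega),\qquad u(x)=g(x)\ \ (x\in\mathbb{R}^N\setminus\Omega).$$ All exterior data below are continuous and bounded on $\mathbb{R}^N\setminus\Omega$. Then the following hold for the chosen problem. (a) (Comparison) If $u_1$ and $u_2$ are the viscosity solutions with exterior data $g_1$ and $g_2$ respectively, then $g_1\ge g_2$ in $\mathbb{R}^N\setminus\Omega$ implies $u_1\ge u_2$ in $\Omega$. (b) (Continuous dependence) With $u_1,u_2,g_1,g_2$ as in (a) (but without assuming $g_1\ge g_2$), $$\|u_1-u_2\|_{L^\infty(\Omega)}\le\|g_1-g_2\|_{L^\infty(\mathbb{R}^N\setminus\Omega)}.$$ (c) (Strong maximum principle) If $u$ is the viscosity solution with exterior datum $g$ and there exists $x_0\in\Omega$ such that $\sup_{y\in\mathbb{R}^N\setminus\Omega}g(y)\le u(x_0)$, then the solution and the exterior datum are constant: there is a constant $c$ with $u\equiv c$ and $g\equiv c$.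
   Context: Fractional eigenvalues: for $i=1,\dots,N$, formally $$\Lambda_i^s u(x)=\max_{\dim S=N-i+1}\ \min_{z\in S,\,|z|=1}\left\{c(s)\,\mathrm{p.v.}\int_{\mathbb{R}}\frac{u(x+tz)-u(x)}{|t|^{1+2s}}\,dt\right\},$$ where $S$ ranges over linear subspaces of $\mathbb{R}^N$ of the indicated dimension and $c(s)=\frac{2^{2s}s\Gamma(s+1/2)}{\pi^{1/2}\Gamma(1-s)}>0$. Since the right-hand sides are $0$, the factor $c(s)$ plays no role and is dropped in the definition of solution below. For bounded $C^2$ domains and continuous bounded exterior data each of the two problems has a unique viscosity solution. Extensions: for a function $u$ defined (at least) on $\overline{\Omega}$, the upper $g$-extension $u^g:\mathbb{R}^N\to\mathbb{R}$ is $u^g=u$ in $\Omega$, $u^g=g$ in $\mathbb{R}^N\setminus\overline{\Omega}$, $u^g=\max\{u,g\}$ on $\partial\Omega$. The lower $g$-extension $u_g$ is defined in the same way with $\min$ in place of $\max$ on $\partial\Omega$. For $\delta>0$, a unit vector $z$, a bounded function $w$ on $\mathbb{R}^N$ and $\phi\in C^2(\mathbb{R}^N)$, set $$E_{z,\delta}(w,\phi,x)=\mathrm{p.v.}\int_{-\delta}^{\delta}\frac{\phi(x+tz)-\phi(x)}{|t|^{1+2s}}dt+\int_{\mathbb{R}\setminus(-\delta,\delta)}\frac{w(x+tz)-w(x)}{|t|^{1+2s}}dt .$$ For the trace problem put $$E_\delta(w,\phi,x)=-\sum_{i=1}^N\ \sup_{\dim S=N-i+1}\ \inf_{z\in S,\,|z|=1}E_{z,\delta}(w,\phi,x);$$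 for the mid-range problem put $$E_\delta(w,\phi,x)=-\Big[\inf_{|z|=1}E_{z,\delta}(w,\phi,x)+\sup_{|z|=1}E_{z,\delta}(w,\phi,x)\Big].$$ Viscosity solutions (for either problem, with the corresponding $E_\delta$): a bounded upper semicontinuous $u:\mathbb{R}^N\to\mathbb{R}$ is a viscosity subsolution if $u\le g$ in $\mathbb{R}^N\setminus\overline{\Omega}$ and, whenever $\delta>0$ and $\phi\in C^2(\mathbb{R}^N)$ are such that $x_0$ is a maximum point of $u-\phi$ in $B_\delta(x_0)$, one has $E_\delta(u^g,\phi,x_0)\le0$ if $x_0\in\Omega$, and $\min\{E_\delta(u^g,\phi,x_0),\,u(x_0)-g(x_0)\}\le0$ if $x_0\in\partial\Omega$. A bounded lower semicontinuous $v:\mathbb{R}^N\to\mathbb{R}$ is a viscosity supersolution if $v\ge g$ in $\mathbb{R}^N\setminus\overline{\Omega}$ and, whenever $x_0$ is a minimum point of $v-\phi$ in $B_\delta(x_0)$, one has $E_\delta(v_g,\phi,x_0)\ge0$ if $x_0\in\Omega$, and $\max\{E_\delta(v_g,\phi,x_0),\,v(x_0)-g(x_0)\}\ge0$ if $x_0\in\partial\Omega$. A viscosity solution is a function that is both a viscosity subsolution and a viscosity supersolution. *)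

(* Defs.v *)
From HB Require Import structures.
From mathcomp Require Import all_boot all_order all_algebra.
From mathcomp Require Import all_classical all_reals all_analysis.

Set Implicit Arguments.
Unset Strict Implicit.
Unset Printing Implicit Defensive.

Import Order.TTheory GRing.Theory Num.Theory.
Import numFieldNormedType.Exports.

Local Open Scope classical_set_scope.
Local Open Scope ring_scope.

(* The library norm on 'rV[R]_N is the sup norm: it is used only for the
   topology and for boundedness. Unit vectors and balls are Euclidean. *)
Definition enorm (R : realType) (N : nat) (x : 'rV[R]_N) : R :=
  Num.sqrt (\sum_(i < N) x 0 i ^+ 2).

Definition eball (R : realType) (N : nat) (x : 'rV[R]_N) (r : R) :
    set 'rV[R]_N :=
  [set y | enorm (y - x) < r].

Definition boundary (T : topologicalType) (A : set T) : set T :=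
  closure A `\` interior A.

Definition partial (R : realType) (N : nat) (i : 'I_N) (f : 'rV[R]_N -> R) :
    'rV[R]_N -> R :=
  fun x => 'D_(delta_mx 0 i) f x.

Definition has_continuous_partials (R : realType) (N : nat)
    (f : 'rV[R]_N -> R) : Prop :=
  forall i : 'I_N,
    (forall x, derivable f x (delta_mx 0 i)) /\ continuous (partial i f).

Definition C2 (R : realType) (N : nat) (f : 'rV[R]_N -> R) : Prop :=
  [/\ continuous f,
      has_continuous_partials f &
      forall i : 'I_N, has_continuous_partials (partial i f)].

(* Near each boundary point, after relabelling the axes and reversing the
   orientation of one of them, Omega is the set of points strictly above the
   graph of a C^2 function of the N - 1 remaining coordinates. The row vector
   [col' j x] is x with its j-th coordinate removed. *)
Definition C2_boundary (R : realType) (N : nat) (Omega : set 'rV[R]_N) : Prop :=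
  forall x0, boundary Omega x0 ->
    exists r (gamma : 'rV[R]_(N.-1) -> R) (j : 'I_N) (b : bool),
      [/\ 0 < r, C2 gamma &
          forall x, eball x0 r x ->
            (Omega x <-> gamma (col' j x) < (-1) ^+ b * x 0 j)].

Definition bounded_C2_domain (R : realType) (N : nat)
    (Omega : set 'rV[R]_N) : Prop :=
  [/\ Omega !=set0, open Omega, connected Omega,
      bounded_set Omega & C2_boundary Omega].

Definition upper_semicontinuous (R : realType) (T : topologicalType)
    (u : T -> R) : Prop :=
  forall x a, u x < a -> \forall y \near x, u y < a.

(* Only the values of g on the complement of Omega are ever relevant. *)
Definition exterior_datum (R : realType) (N : nat) (Omega : set 'rV[R]_N)
    (g : 'rV[R]_N -> R) : Prop :=
  {within ~` Omega, continuous g} /\ [bounded g x | x in ~` Omega].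

(* The last branch is the boundary when Omega is open. *)
Definition upper_ext (R : realType) (N : nat) (Omega : set 'rV[R]_N)
    (g u : 'rV[R]_N -> R) : 'rV[R]_N -> R :=
  fun x => if x \in Omega then u x
           else if x \in ~` closure Omega then g x
           else Num.max (u x) (g x).

Definition lower_ext (R : realType) (N : nat) (Omega : set 'rV[R]_N)
    (g u : 'rV[R]_N -> R) : 'rV[R]_N -> R :=
  fun x => if x \in Omega then u x
           else if x \in ~` closure Omega then g x
           else Num.min (u x) (g x).

Definition frac_quotient (R : realType) (N : nat) (s : R) (z : 'rV[R]_N)
    (w : 'rV[R]_N -> R) (x : 'rV[R]_N) (t : R) : R :=
  (w (x + t *: z) - w x) / (`|t| `^ (1 + 2 * s)).

(* The library's [lim], [sup] and [inf] are total. They have their usual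
   meaning here for s < 1, w bounded Borel, phi of class C^2, 0 < delta: the
   principal value converges and E_dir is bounded uniformly in z. *)
Definition E_dir (R : realType) (N : nat) (s : R) (z : 'rV[R]_N) (delta : R)
    (w phi : 'rV[R]_N -> R) (x : 'rV[R]_N) : R :=
  lim ((\int[lebesgue_measure]_(t in [set t : R | eps < `|t| < delta])
          frac_quotient s z phi x t) @[eps --> 0^'+])
  + \int[lebesgue_measure]_(t in [set t : R | delta <= `|t|])
      frac_quotient s z w x t.

Definition E_trace (R : realType) (N : nat) (s delta : R)
    (w phi : 'rV[R]_N -> R) (x : 'rV[R]_N) : R :=
  - \sum_(1 <= i < N.+1)
      sup [set inf [set E_dir s z delta w phi x
                   | z in [set z : 'rV[R]_N | z \in S /\ enorm z = 1]]
          | S in [set S : {vspace 'rV[R]_N} | \dim S = (N - i + 1)%N]].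

Definition E_midrange (R : realType) (N : nat) (s delta : R)
    (w phi : 'rV[R]_N -> R) (x : 'rV[R]_N) : R :=
  - (inf [set E_dir s z delta w phi x
         | z in [set z : 'rV[R]_N | enorm z = 1]]
     + sup [set E_dir s z delta w phi x
           | z in [set z : 'rV[R]_N | enorm z = 1]]).

Inductive problem := Trace | Midrange.

Definition E_problem (p : problem) (R : realType) (N : nat) (s delta : R)
    (w phi : 'rV[R]_N -> R) (x : 'rV[R]_N) : R :=
  match p with
  | Trace => E_trace s delta w phi x
  | Midrange => E_midrange s delta w phi x
  end.

Definition viscosity_subsolution (p : problem) (R : realType) (N : nat) (s : R)
    (Omega : set 'rV[R]_N) (g u : 'rV[R]_N -> R) : Prop :=
  [/\ bounded_fun u,
      upper_semicontinuous u,
      forall x, (~` closure Omega) x -> u x <= g x &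
      forall (delta : R) (phi : 'rV[R]_N -> R) (x0 : 'rV[R]_N),
        0 < delta -> C2 phi ->
        (forall y, eball x0 delta y -> u y - phi y <= u x0 - phi x0) ->
        (Omega x0 -> E_problem p s delta (upper_ext Omega g u) phi x0 <= 0)
        /\ (boundary Omega x0 ->
            Num.min (E_problem p s delta (upper_ext Omega g u) phi x0)
                    (u x0 - g x0) <= 0)].

Definition viscosity_supersolution (p : problem) (R : realType) (N : nat)
    (s : R) (Omega : set 'rV[R]_N) (g v : 'rV[R]_N -> R) : Prop :=
  [/\ bounded_fun v,
      lower_semicontinuous (EFin \o v),
      forall x, (~` closure Omega) x -> g x <= v x &
      forall (delta : R) (phi : 'rV[R]_N -> R) (x0 : 'rV[R]_N),
        0 < delta -> C2 phi ->
        (forall y, eball x0 delta y -> v x0 - phi x0 <= v y - phi y) ->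
        (Omega x0 -> 0 <= E_problem p s delta (lower_ext Omega g v) phi x0)
        /\ (boundary Omega x0 ->
            0 <= Num.max (E_problem p s delta (lower_ext Omega g v) phi x0)
                         (v x0 - g x0))].

Definition viscosity_solution (p : problem) (R : realType) (N : nat) (s : R)
    (Omega : set 'rV[R]_N) (g u : 'rV[R]_N -> R) : Prop :=
  viscosity_subsolution p s Omega g u /\ viscosity_supersolution p s Omega g u.

(* Sets of zero N-dimensional Lebesgue outer measure: for every e > 0 there is
   a countable cover by closed boxes with total volume at most e. *)
Definition lebesgue_null (R : realType) (N : nat) (A : set 'rV[R]_N) : Prop :=
  forall e : R, 0 < e ->
    exists a b : nat -> 'rV[R]_N,
      [/\ forall k i, a k 0 i <= b k 0 i,
          A `<=` \bigcup_k
            [set x : 'rV[R]_N | forall i, a k 0 i <= x 0 i <= b k 0 i] &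
          (\sum_(0 <= k <oo) (\prod_(i < N) (b k 0 i - a k 0 i))%:E
             <= e%:E)%E].

Definition Linfty_norm (R : realType) (N : nat) (D : set 'rV[R]_N)
    (f : 'rV[R]_N -> R) : \bar R :=
  ereal_inf [set M%:E | M in
    [set M : R | 0 <= M
      /\ lebesgue_null [set x : 'rV[R]_N | D x /\ M < `|f x|]]].

(* Main.v *)
(* The semicontinuity requirements make a viscosity solution continuous on the
   whole space, and near the boundary of a C^2 domain there are exterior points,
   so a solution agrees with its datum on the complement of the domain: both
   extensions are the solution itself, and boundary test points play no role.

   Comparison is by doubling variables with the penalty k |x - y|^2. At a
   maximum point (x, y) the increments of u2 at x along any line are dominated
   by those of u1 at y; where the line has left the domain there is a gap, which
   gives a gain uniform in the direction, while the local part contributes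
   O(k delta^(2 - 2 s)), negligible once delta is small. A uniform
   strict inequality between directional operators survives the sup-inf over
   subspaces. Continuous dependence is the same argument with data shifted by a
   constant, once a null open set is known to be empty. At an interior global
   maximum every directional operator is nonpositive, and the equation forces
   all of them to vanish, so the solution is constant along all lines. *)

Require Import Defs.
From HB Require Import structures.
From mathcomp Require Import all_boot all_order all_algebra.
From mathcomp Require Import ring lra.
From mathcomp Require Import all_classical all_reals all_analysis.
From mathcomp Require Import measurable_realfun.

Set Implicit Arguments.
Unset Strict Implicit.
Unset Printing Implicit Defensive.

Import Order.TTheory GRing.Theory Num.Theory.
Import numFieldNormedType.Exports.

Local Open Scope classical_set_scope.
Local Open Scope ring_scope.

(** * The Levy kernel on the line *)

Lemma powR_cvgy (R : realType) (p : R) : 0 < p -> x `^ p @[x --> +oo] --> +oo.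
Proof.
move=> p0; apply/cvgryPge => A.
have [m m1 Am] : exists2 m, 1 <= m & A <= m.
  by exists (Num.max 1 A); rewrite le_max lexx// orbT.
have m0 : 0 <= m by exact: le_trans m1.
near=> x.
have mx : m `^ p^-1 <= x by near: x; exact: nbhs_pinfty_ge.
apply: (le_trans Am).
have -> : m = (m `^ p^-1) `^ p by rewrite -powRrM mulVf ?gt_eqF// powRr1.
by apply: (ge0_ler_powR (ltW p0)) mx; rewrite nnegrE ?powR_ge0.
Unshelve. all: by end_near. Qed.

Lemma powRN_cvg0 (R : realType) (p : R) :
  0 < p -> x `^ (- p) @[x --> +oo] --> 0.
Proof.
move=> p0; under eq_fun do rewrite powRN.
apply/(@gtr0_cvgV0 _ _ _ _ (fun x : R => x `^ p)); last exact: powR_cvgy.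
by near=> x; apply: powR_gt0.
Unshelve. all: by end_near. Qed.

Lemma powR_continuous_gt0 (R : realType) (p x : R) :
  0 < x -> {for x, continuous (fun y => y `^ p)}.
Proof.
move=> x0; apply/differentiable_continuous/derivable1_diffP.
by apply: derivable_powR; rewrite in_itv/= x0.
Qed.

Lemma powR_primitive (R : realType) (p x : R) : p != 0 -> 0 < x ->
  derivable (fun y => p^-1 * y `^ p) x 1 /\
  derive1 (fun y => p^-1 * y `^ p) x = x `^ (p - 1).
Proof.
move=> p0 x0.
have d : derivable (fun y : R => y `^ p) x 1.
  by apply: derivable_powR; rewrite in_itv/= x0.
split; first by apply: derivableM => //; exact: derivable_cst.
rewrite derive1Ml// powR_derive1 ?in_itv/= ?x0//.
by rewrite mulrA mulVf ?mul1r.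
Qed.

Section even.
Context (R : realType).
Local Notation mu := (@lebesgue_measure R).

Lemma measurable_abs_preimage (D : set R) : measurable D ->
  measurable [set t : R | D `|t|].
Proof.
move=> mD; rewrite -[X in measurable X]setTI.
exact: (@normr_measurable R setT) mD.
Qed.

(** The domain splits into [D] and its mirror image, disjoint because [D] lies in the positive
    half-line, and Lebesgue measure is invariant under reflection. *)
Lemma ge0_integral_even (D : set R) (f : R -> \bar R) :
  measurable D -> D `<=` [set t | 0 < t] ->
  measurable_fun setT f -> (forall t, (0 <= f t)%E) ->
  (forall t, f (- t) = f t) ->
  (\int[mu]_(t in [set t : R | D `|t|%R]) f t = 2%:E * \int[mu]_(t in D) f t)%E.
Proof.
move=> mD D0 mf f0 fe.
have DE : [set t : R | D `|t|] = D `|` (-%R : _ -> measurableTypeR R) @^-1` D.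
  apply/seteqP; split=> t /=.
  - by case: (ger0P t) => _; [left|right].
  - move=> [Dt|Dt]; first by rewrite gtr0_norm//; exact: D0.
    by rewrite ltr0_norm// -oppr_gt0; exact: D0.
have mD' : measurable ((-%R : R -> R) @^-1` D).
  by rewrite -[X in measurable X]setTI; exact: (@oppr_measurable R setT).
rewrite DE ge0_integral_setU//; last 2 first.
- exact: measurable_funS mf.
- apply/disj_setPS => t [/D0/= t0 /D0/=]; rewrite oppr_gt0 => tn.
  by have := lt_trans t0 tn; rewrite ltxx.
rewrite (_ : 2%:E = 1 + 1)%E// ge0_muleDl ?lee01// !mul1e; congr (_ + _)%E.
transitivity (\int[pushforward mu (-%R : _ -> measurableTypeR R)]_(t in D) f t)%E.
  rewrite ge0_integral_pushforward//; last exact: measurable_funS mf.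
  by apply: eq_integral => t _ /=; rewrite fe.
by apply: eq_measure_integral => A mA _; exact: lebesgue_measureN.
Qed.

End even.

Definition levy_kernel (R : realType) (s t : R) : R := `|t| `^ (- (1 + 2 * s)).

Lemma levy_kernel_ge0 (R : realType) (s t : R) : 0 <= levy_kernel s t.
Proof. exact: powR_ge0. Qed.

Lemma levy_kernel_gt0 (R : realType) (s t : R) : t != 0 -> 0 < levy_kernel s t.
Proof. by move=> t0; rewrite powR_gt0// normr_gt0. Qed.

Lemma levy_kernelN (R : realType) (s t : R) :
  levy_kernel s (- t) = levy_kernel s t.
Proof. by rewrite /levy_kernel normrN. Qed.

Lemma measurable_levy_kernel (R : realType) (s : R) :
  measurable_fun setT (levy_kernel s).
Proof.
apply: (@measurableT_comp _ _ _ _ _ _ (fun x : R => x `^ (- (1 + 2 * s))) _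
  (@Num.norm _ R)); last exact: normr_measurable.
exact: measurable_powR.
Qed.

Lemma frac_quotientE (R : realType) (N : nat) (s : R) (z : 'rV[R]_N)
    (w : 'rV[R]_N -> R) (x : 'rV[R]_N) (t : R) :
  frac_quotient s z w x t = (w (x + t *: z) - w x) * levy_kernel s t.
Proof. by rewrite /frac_quotient /levy_kernel powRN. Qed.

Section levy_kernel_integral.
Context (R : realType).
Local Notation mu := (@lebesgue_measure R).

Lemma measurable_abs_ge (a : R) : measurable [set t : R | a <= `|t|].
Proof.
have -> : [set t : R | a <= `|t|] = [set t : R | `[a, +oo[%classic `|t|].
  by apply/seteqP; split=> t /=; rewrite in_itv/= andbT.
exact: (@measurable_abs_preimage R `[a, +oo[%classic (measurable_itv _)).
Qed.

Lemma measurable_annulus (a b : R) : measurable [set t : R | a < `|t| < b].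
Proof.
exact: (@measurable_abs_preimage R `]a, b[%classic (measurable_itv _)).
Qed.

(** After folding onto the half-line, t^p / p with p = -2s is a primitive that vanishes at
    infinity. *)
Lemma integral_levy_kernel_tail (s a : R) : 0 < s -> 0 < a ->
  (\int[mu]_(t in [set t : R | (a <= `|t|)%R]) (levy_kernel s t)%:E
   = (s^-1 * a `^ (- (2 * s)))%:E)%E.
Proof.
move=> s0 a0.
have -> : [set t : R | a <= `|t|] = [set t : R | `[a, +oo[%classic `|t|].
  by apply/seteqP; split=> t /=; rewrite in_itv/= andbT.
rewrite ge0_integral_even//; last 4 first.
- by move=> t /=; rewrite in_itv/= andbT; exact: lt_le_trans.
- apply/measurable_EFinP. exact: measurable_levy_kernel.
- by move=> t; rewrite lee_fin levy_kernel_ge0.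
- by move=> t; rewrite levy_kernelN.
pose p := - (2 * s).
have p0 : p != 0 by rewrite oppr_eq0 mulf_neq0// gt_eqF.
have pE : p - 1 = - (1 + 2 * s) by rewrite /p; ring.
have -> : (\int[mu]_(t in `[a, +oo[) (levy_kernel s t)%:E
           = \int[mu]_(t in `[a, +oo[) (t `^ (p - 1))%:E)%E.
  apply: eq_integral => t; rewrite inE/= in_itv/= andbT => at_.
  by rewrite /levy_kernel -pE ger0_norm// (le_trans (ltW a0)).
rewrite (@ge0_continuous_FTC2y _ _ (fun t => p^-1 * t `^ p) a 0).
- rewrite -EFinB -EFinM; congr EFin; rewrite sub0r /p invrN.
  by field; rewrite gt_eqF.
- by move=> t _; exact: powR_ge0.
- apply: continuous_in_subspaceT => t; rewrite inE/= in_itv/= andbT => at_.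
  by apply: powR_continuous_gt0; exact: lt_le_trans at_.
- rewrite -[X in _ --> X](mulr0 p^-1); apply: cvgMr.
  by apply: powRN_cvg0; rewrite mulr_gt0.
- by move=> t /(lt_trans a0) t0; case: (powR_primitive p0 t0).
- apply: cvg_at_right_filter; apply: cvgMr.
  exact: powR_continuous_gt0.
- move=> t; rewrite in_itv/= andbT => /(lt_trans a0) t0.
  by case: (powR_primitive p0 t0).
Qed.

(** The primitive is now t^p / p with p = 2 - 2s. Since [s < 1] makes p positive, the value stays
    bounded as the inner radius shrinks. *)
Lemma integral_levy_kernel_sqr_annulus (s e d : R) : s < 1 -> 0 < e -> e < d ->
  (\int[mu]_(t in [set t : R | (e < `|t| < d)%R]) (t ^+ 2 * levy_kernel s t)%:E
   = ((1 - s)^-1 * (d `^ (2 - 2 * s) - e `^ (2 - 2 * s)))%:E)%E.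
Proof.
move=> s1 e0 ed.
have -> : [set t : R | e < `|t| < d] = [set t : R | `]e, d[%classic `|t|] by [].
have mf : measurable_fun setT (fun t : R => t ^+ 2 * levy_kernel s t).
  apply: measurable_funM; first exact: exprn_measurable.
  exact: measurable_levy_kernel.
rewrite ge0_integral_even//; last 4 first.
- by move=> t /=; rewrite in_itv/= => /andP[et _]; exact: lt_trans et.
- exact/measurable_EFinP.
- by move=> t; rewrite lee_fin mulr_ge0 ?sqr_ge0 ?levy_kernel_ge0.
- by move=> t; rewrite levy_kernelN sqrrN.
(* The endpoints are null; the fundamental theorem of calculus is stated on the closed interval. *)
rewrite -(@integral_itv_bndoo R e d _ true false); last first.
  by apply/measurable_EFinP; exact: measurable_funTS.
pose p := 2 - 2 * s.
have p0 : 0 < p by rewrite /p; lra.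
have pE : p - 1 = 2 - (1 + 2 * s) by rewrite /p; ring.
have -> : (\int[mu]_(t in `[e, d]) (t ^+ 2 * levy_kernel s t)%:E
           = \int[mu]_(t in `[e, d]) (t `^ (p - 1))%:E)%E.
  apply: eq_integral => t; rewrite inE/= in_itv/= => /andP[et _].
  have t0 : 0 < t by exact: lt_le_trans et.
  rewrite /levy_kernel gtr0_norm// pE powRD; last first.
    by apply/implyP => _; exact: lt0r_neq0.
  by rewrite powR_mulrn// ltW.
rewrite (@continuous_FTC2 _ _ (fun t => p^-1 * t `^ p)).
- rewrite -EFinB -EFinM; congr EFin; rewrite /p.
  by field; rewrite -/p !gt_eqF// subr_gt0.
- by [].
- apply: continuous_in_subspaceT => t; rewrite inE/= in_itv/= => /andP[et _].
  by apply: powR_continuous_gt0; exact: lt_le_trans et.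
- split.
  + move=> t; rewrite in_itv/= => /andP[et _].
    by case: (powR_primitive (lt0r_neq0 p0) (lt_trans e0 et)).
  + apply: cvg_at_right_filter; apply: cvgMr.
    exact: powR_continuous_gt0.
  + apply: cvg_at_left_filter; apply: cvgMr.
    exact/powR_continuous_gt0/(lt_trans e0).
- move=> t; rewrite in_itv/= => /andP[et _].
  by case: (powR_primitive (lt0r_neq0 p0) (lt_trans e0 et)).
Qed.

End levy_kernel_integral.

Section levy_integrable.
Context (R : realType).
Local Notation mu := (@lebesgue_measure R).

Lemma integrable_levy_kernel (s a : R) : 0 < s -> 0 < a ->
  mu.-integrable [set t : R | a <= `|t|] (EFin \o levy_kernel s).
Proof.
move=> s0 a0; apply/integrableP; split.
  by apply/measurable_EFinP/measurable_funTS; exact: measurable_levy_kernel.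
rewrite (_ : integral _ _ _ = (s^-1 * a `^ (- (2 * s)))%:E) ?ltry//.
rewrite -(integral_levy_kernel_tail s0 a0); apply: eq_integral => t _ /=.
by rewrite ger0_norm ?levy_kernel_ge0.
Qed.

Lemma integrable_bounded_levy_kernel (s a C : R) (D : set R) (f : R -> R) :
  0 < s -> 0 < a -> measurable D -> D `<=` [set t | a <= `|t|] ->
  measurable_fun setT f -> (forall t, D t -> `|f t| <= C) ->
  mu.-integrable D (EFin \o (fun t => f t * levy_kernel s t)).
Proof.
move=> s0 a0 mD Da mf fC.
apply: (@le_integrable _ _ _ mu D mD _
  (fun t => C%:E * (EFin \o levy_kernel s) t)%E).
- apply/measurable_EFinP/measurable_funTS/measurable_funM => //.
  exact: measurable_levy_kernel.
- move=> t Dt; rewrite /= lee_fin !normrM ler_pM//.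
  by rewrite (le_trans (fC t Dt))// ler_norm.
- apply: integrableZl => //.
  apply: integrableS (integrable_levy_kernel s0 a0) => //.
  exact: measurable_abs_ge.
Qed.

Lemma integrable_EFinZl (D : set R) (r : R) (f : R -> R) : measurable D ->
  mu.-integrable D (EFin \o f) -> mu.-integrable D (EFin \o (fun t => r * f t)).
Proof. by move=> mD; exact: integrableZl. Qed.

Lemma integrable_EFinD (D : set R) (f g : R -> R) : measurable D ->
  mu.-integrable D (EFin \o f) -> mu.-integrable D (EFin \o g) ->
  mu.-integrable D (EFin \o (fun t => f t + g t)).
Proof. by move=> mD; exact: integrableD. Qed.

Lemma integrable_EFinB (D : set R) (f g : R -> R) : measurable D ->
  mu.-integrable D (EFin \o f) -> mu.-integrable D (EFin \o g) ->
  mu.-integrable D (EFin \o (fun t => f t - g t)).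
Proof. by move=> mD; exact: integrableB. Qed.

(** Reflection preserves both the measure and [D], so the integral equals its own opposite. *)
Lemma Rintegral_odd (D : set R) (f : R -> R) : measurable D ->
  (forall t, D (- t) <-> D t) -> measurable_fun setT f ->
  mu.-integrable D (EFin \o f) -> (forall t, f (- t) = - f t) ->
  \int[mu]_(t in D) f t = 0.
Proof.
move=> mD Dsym mf fint fodd.
have DN : (-%R : R -> measurableTypeR R) @^-1` D = D.
  by apply/seteqP; split=> t /=; rewrite Dsym.
have : (\int[mu]_(t in D) (f t)%:E = \int[mu]_(t in D) (- f t)%:E)%E.
  transitivity (\int[pushforward mu (-%R : _ -> measurableTypeR R)]_(t in D)
      (f t)%:E)%E.
    by apply: eq_measure_integral => A mA _; exact/esym/lebesgue_measureN.
  rewrite integral_pushforward//; last 2 first.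
  - exact/measurable_EFinP.
  - rewrite DN; apply: eq_integrable (integrableN fint) => // t _ /=.
    by rewrite fodd.
  by rewrite DN; apply: eq_integral => t _ /=; rewrite fodd.
move/(congr1 fine); rewrite -!/(Rintegral _ _ _).
have -> : \int[mu]_(t in D) (- f t) = - \int[mu]_(t in D) f t.
  under eq_Rintegral do rewrite -mulN1r.
  by rewrite RintegralZl// mulN1r.
by move=> h; lra.
Qed.

End levy_integrable.

(** * Paraboloids as test functions *)

(** The doubling penalty with one variable frozen. The squared Euclidean distance is written as a
    sum, so that restrictions to lines are visibly quadratic; [k = 0] gives a constant test
    function. *)
Definition paraboloid (R : realType) (N : nat) (c k : R) (y x : 'rV[R]_N) : R :=
  c + k * \sum_(i < N) (x 0 i - y 0 i) ^+ 2.

Lemma sum_sqr_enorm1 (R : realType) (N : nat) (z : 'rV[R]_N) :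
  enorm z = 1 -> \sum_(i < N) z 0 i ^+ 2 = 1.
Proof.
move=> z1; rewrite -[LHS]sqr_sqrtr ?sumr_ge0// => [|i _]; last exact: sqr_ge0.
by rewrite -/(enorm z) z1 expr1n.
Qed.

Lemma paraboloid_line (R : realType) (N : nat) (c k : R) (y x z : 'rV[R]_N)
    (t : R) : enorm z = 1 ->
  paraboloid c k y (x + t *: z) - paraboloid c k y x =
  (2 * k * \sum_(i < N) (x 0 i - y 0 i) * z 0 i) * t + k * t ^+ 2.
Proof.
move=> /sum_sqr_enorm1 z1; rewrite /paraboloid.
have -> : \sum_(i < N) ((x + t *: z) 0 i - y 0 i) ^+ 2 =
    \sum_(i < N) (x 0 i - y 0 i) ^+ 2 +
    (2 * t * (\sum_(i < N) (x 0 i - y 0 i) * z 0 i) + t ^+ 2).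
  rewrite -[X in _ + (_ + X)]mulr1 -[X in _ + (_ + _ * X)]z1.
  rewrite !mulr_sumr -!big_split/=; apply: eq_bigr => i _.
  by rewrite !mxE; ring.
ring.
Qed.

(** On each symmetric annulus the linear part of the increment is odd and integrates to 0. Only the
    quadratic part remains, with a value that depends neither on the direction nor on the base
    point. *)
Lemma pv_paraboloid (R : realType) (N : nat) (s : R) (z : 'rV[R]_N)
    (d c k : R) (y x : 'rV[R]_N) : 0 < s -> s < 1 -> 0 < d -> enorm z = 1 ->
  lim ((\int[lebesgue_measure]_(t in [set t : R | eps < `|t| < d])
          frac_quotient s z (paraboloid c k y) x t) @[eps --> 0^'+])
  = k * ((1 - s)^-1 * d `^ (2 - 2 * s)).
Proof.
move=> s0 s1 d0 z1; apply: cvg_lim => //.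
pose p := 2 - 2 * s; have p0 : 0 < p by rewrite /p; lra.
pose b := 2 * k * \sum_(i < N) (x 0 i - y 0 i) * z 0 i.
have near_eq : \forall eps \near 0^'+,
    k * ((1 - s)^-1 * (d `^ p - eps `^ p)) =
    \int[lebesgue_measure]_(t in [set t : R | eps < `|t| < d])
          frac_quotient s z (paraboloid c k y) x t.
  near=> e.
  have e0 : 0 < e by near: e; exact: nbhs_right_gt.
  have ed : e < d by near: e; exact: nbhs_right_lt.
  set D := [set t : R | e < `|t| < d].
  have mD : measurable D by exact: measurable_annulus.
  have De : D `<=` [set t | e <= `|t|] by move=> t /= /andP[/ltW].
  have i1 : lebesgue_measure.-integrable D
      (EFin \o (fun t : R => t * levy_kernel s t)).
    apply: (@integrable_bounded_levy_kernel R s e d D id s0 e0 mD De) => //.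
    by move=> t /andP[_ /ltW].
  have i2 : lebesgue_measure.-integrable D
      (EFin \o (fun t : R => t ^+ 2 * levy_kernel s t)).
    apply: (@integrable_bounded_levy_kernel R s e (d ^+ 2) D (fun t => t ^+ 2)
      s0 e0 mD De) => //.
    by move=> t /andP[_ /ltW td]; rewrite normrX lerXn2r// nnegrE ltW.
  transitivity (\int[lebesgue_measure]_(t in D)
      (b * (t * levy_kernel s t) + k * (t ^+ 2 * levy_kernel s t))).
    rewrite RintegralD//; [|exact: integrable_EFinZl..].
    rewrite !RintegralZl// Rintegral_odd//; first last.
    - by move=> t; rewrite levy_kernelN mulNr.
    - by apply: measurable_funM => //; exact: measurable_levy_kernel.
    - by move=> t; rewrite /D/= normrN.
    rewrite mulr0 add0r /Rintegral integral_levy_kernel_sqr_annulus//.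
  apply: eq_Rintegral => t _.
  by rewrite frac_quotientE paraboloid_line// -/b; ring.
apply: cvg_trans (near_eq_cvg near_eq) _.
have : k * ((1 - s)^-1 * (d `^ p - e `^ p)) @[e --> 0^'+] -->
    k * ((1 - s)^-1 * (d `^ p - 0)).
  apply: cvgMr; apply: cvgMr; apply: cvgB; first exact: cvg_cst.
  exact: powR_cvg0.
by rewrite subr0.
Unshelve. all: by end_near. Qed.

(** * The directional operator *)

Lemma continuous_line (R : realType) (N : nat) (x z : 'rV[R]_N) :
  continuous (fun t : R => x + t *: z).
Proof.
move=> t; apply: cvgD; first exact: cvg_cst.
by apply: cvgZr_tmp; exact: cvg_id.
Qed.

Lemma measurable_increment (R : realType) (N : nat) (w : 'rV[R]_N -> R)
    (x z : 'rV[R]_N) : continuous w ->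
  measurable_fun setT (fun t : R => w (x + t *: z) - w x).
Proof.
move=> cw; apply: measurable_funB => //.
apply: continuous_measurable_fun => t.
by apply: (@continuous_comp _ _ _ (fun t : R => x + t *: z) w);
  [exact: continuous_line|exact: cw].
Qed.

Lemma integrable_frac_quotient (R : realType) (N : nat) (s a C : R)
    (w : 'rV[R]_N -> R) (x z : 'rV[R]_N) :
  0 < s -> 0 < a -> continuous w -> (forall y, `|w y| <= C) ->
  lebesgue_measure.-integrable [set t : R | a <= `|t|]
    (EFin \o frac_quotient s z w x).
Proof.
move=> s0 a0 cw wC.
rewrite (_ : frac_quotient s z w x =
    fun t => (w (x + t *: z) - w x) * levy_kernel s t); last first.
  by apply/funext => t; rewrite frac_quotientE.
apply: (@integrable_bounded_levy_kernel R s a (C + C) _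
  (fun t => w (x + t *: z) - w x)) => //.
- exact: measurable_abs_ge.
- exact: measurable_increment.
- by move=> t _; rewrite (le_trans (ler_normB _ _))// lerD.
Qed.

Lemma E_dir_paraboloid (R : realType) (N : nat) (s d c k : R)
    (w : 'rV[R]_N -> R) (x y z : 'rV[R]_N) :
  0 < s -> s < 1 -> 0 < d -> enorm z = 1 ->
  E_dir s z d w (paraboloid c k y) x =
  k * ((1 - s)^-1 * d `^ (2 - 2 * s)) +
  \int[lebesgue_measure]_(t in [set t : R | d <= `|t|]) frac_quotient s z w x t.
Proof. by move=> s0 s1 d0 z1; rewrite /E_dir pv_paraboloid. Qed.

Lemma Rintegral_levy_kernel_tail (R : realType) (s a : R) : 0 < s -> 0 < a ->
  \int[lebesgue_measure]_(t in [set t : R | a <= `|t|]) levy_kernel s t =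
  s^-1 * a `^ (- (2 * s)).
Proof. by move=> s0 a0; rewrite /Rintegral integral_levy_kernel_tail. Qed.

(** A bound uniform in the direction guarantees that the infima and suprema over directions are
    genuine, not default values. *)
Lemma E_dir_bounded (R : realType) (N : nat) (s d c k C : R)
    (w : 'rV[R]_N -> R) (x y : 'rV[R]_N) :
  0 < s -> s < 1 -> 0 < d -> continuous w -> (forall y, `|w y| <= C) ->
  exists K, forall z, enorm z = 1 ->
    `|E_dir s z d w (paraboloid c k y) x| <= K.
Proof.
move=> s0 s1 d0 cw wC.
exists (`|k * ((1 - s)^-1 * d `^ (2 - 2 * s))| +
  (C + C) * (s^-1 * d `^ (- (2 * s)))) => z z1.
rewrite E_dir_paraboloid// (le_trans (ler_normD _ _))// lerD2l.
have fint := integrable_frac_quotient x z s0 d0 cw wC.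
have mA := measurable_abs_ge d.
apply: le_trans; first by apply: le_normr_Rintegral; [exact: mA|exact: fint].
rewrite -(Rintegral_levy_kernel_tail s0 d0) -RintegralZl//; last first.
  exact: integrable_levy_kernel.
apply: le_Rintegral => //.
- exact: integrable_norm.
- by apply: integrable_EFinZl => //; exact: integrable_levy_kernel.
- move=> t _; rewrite frac_quotientE normrM (ger0_norm (levy_kernel_ge0 _ _)).
  rewrite ler_wpM2r ?levy_kernel_ge0//.
  by rewrite (le_trans (ler_normB _ _))// lerD.
Qed.

(* In the comparison argument [a] is a length beyond which lines have left the
   domain, so that a gap [m] is gained; beyond [T] only the crude bound [4 * C]
   is available. *)
Lemma E_dir_doubling (R : realType) (N : nat) (s d a T m C c c' k : R)
    (u1 u2 : 'rV[R]_N -> R) (x y z : 'rV[R]_N) :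
  0 < s -> s < 1 -> 0 < d -> d <= a -> a <= T ->
  continuous u1 -> continuous u2 ->
  (forall y, `|u1 y| <= C) -> (forall y, `|u2 y| <= C) -> enorm z = 1 ->
  (forall t, `|t| <= T ->
     u2 (x + t *: z) - u2 x <= u1 (y + t *: z) - u1 y) ->
  (forall t, a <= `|t| <= T ->
     u2 (x + t *: z) - u2 x <= u1 (y + t *: z) - u1 y - m) ->
  E_dir s z d u2 (paraboloid c k y) x <=
  E_dir s z d u1 (paraboloid c' (- k) x) y
  + (2 * k * ((1 - s)^-1 * d `^ (2 - 2 * s))
     - m * (s^-1 * a `^ (- (2 * s)))
     + (m + 4 * C) * (s^-1 * T `^ (- (2 * s)))).
Proof.
move=> s0 s1 d0 da aT c1 c2 u1C u2C z1 h1 h2.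
have a0 : 0 < a by exact: lt_le_trans da.
have T0 : 0 < T by exact: lt_le_trans aT.
rewrite !E_dir_paraboloid//.
set A := fun r : R => [set t : R | r <= `|t|].
have mA r : measurable (A r) by exact: measurable_abs_ge.
have i1 := integrable_frac_quotient y z s0 d0 c1 u1C.
have i2 := integrable_frac_quotient x z s0 d0 c2 u2C.
(* Kernels cut off at radius [r] keep all integrals on the single domain [A d], where the integrands
   can be compared pointwise. *)
have iK r : 0 < r -> lebesgue_measure.-integrable (A d)
    (EFin \o (levy_kernel s \_ (A r))).
  move=> r0; rewrite -restrict_EFin.
  apply/integrable_restrict; do ?exact: mA.
  apply: integrableS (integrable_levy_kernel s0 r0); first exact: mA.
  - by apply: measurableI; exact: mA.
  - by move=> t [].
have IK r : d <= r ->
    \int[lebesgue_measure]_(t in A d) (levy_kernel s \_ (A r)) t =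
    s^-1 * r `^ (- (2 * s)).
  move=> dr; rewrite -Rintegral_mkcondr (_ : A d `&` A r = A r).
    by rewrite Rintegral_levy_kernel_tail// (lt_le_trans d0).
  by apply/seteqP; split=> t /=; [case|move=> rt; split=> //; exact: le_trans rt].
suff : \int[lebesgue_measure]_(t in A d) frac_quotient s z u2 x t
    - \int[lebesgue_measure]_(t in A d) frac_quotient s z u1 y t <=
    (- m) * (s^-1 * a `^ (- (2 * s))) + (m + 4 * C) * (s^-1 * T `^ (- (2 * s))).
  by rewrite /A; lra.
have iZK r b : 0 < r -> lebesgue_measure.-integrable (A d)
    (EFin \o (fun t : R => b * (levy_kernel s \_ (A r)) t)).
  by move=> r0; apply: integrable_EFinZl; [exact: mA|exact: iK].
have -> : (- m) * (s^-1 * a `^ (- (2 * s)))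
      + (m + 4 * C) * (s^-1 * T `^ (- (2 * s))) =
    \int[lebesgue_measure]_(t in A d) ((- m) * (levy_kernel s \_ (A a)) t
      + (m + 4 * C) * (levy_kernel s \_ (A T)) t).
  rewrite RintegralD; [|exact: mA|exact: iZK..].
  by rewrite !RintegralZl; rewrite ?IK ?(le_trans da); do ?exact: mA;
    do ?exact: iK.
have -> : \int[lebesgue_measure]_(t in A d) frac_quotient s z u2 x t
    - \int[lebesgue_measure]_(t in A d) frac_quotient s z u1 y t =
    \int[lebesgue_measure]_(t in A d)
      (frac_quotient s z u2 x t - frac_quotient s z u1 y t).
  by rewrite RintegralB; [by []|exact: mA|exact: i2|exact: i1].
apply: le_Rintegral; first exact: mA.
- by apply: integrable_EFinB; [exact: mA|exact: i2|exact: i1].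
- by apply: integrable_EFinD; [exact: mA|exact: iZK..].
(* Three ranges. Beyond [T] the increments differ by at most [4 * C], and the extra [m] there
   cancels the [- m] of the larger tail; between [a] and [T] the gap [m] is gained; below [a] the
   plain comparison suffices. *)
move=> t /= dt; rewrite !frac_quotientE -mulrBl !patchE.
have k0 := levy_kernel_ge0 s t.
have [Tt|tT] := lerP T `|t|.
  rewrite !mem_set/A/= ?(le_trans aT)// -mulrDl ler_wpM2r//.
  have := u1C (y + t *: z); have := u1C y.
  have := u2C (x + t *: z); have := u2C x.
  by rewrite !ler_norml => /andP[? ?] /andP[? ?] /andP[? ?] /andP[? ?]; lra.
rewrite (memNset (_ : ~ A T t)); last by apply/negP; rewrite -ltNge.
rewrite mulr0 addr0.
have [at_|ta] := lerP a `|t|.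
  rewrite mem_set// ler_wpM2r//.
  by have := h2 t; rewrite at_ (ltW tT) => /(_ isT); lra.
rewrite (memNset (_ : ~ A a t)); last by apply/negP; rewrite -ltNge.
rewrite mulr0 mulr_le0_ge0//.
by have := h1 t (ltW tT); lra.
Qed.

(** * Sup-inf over subspaces *)

Lemma le_inf_image (R : realType) (T : Type) (A : set T) (f g : T -> R) :
  A !=set0 -> has_lbound (f @` A) -> (forall x, A x -> f x <= g x) ->
  inf (f @` A) <= inf (g @` A).
Proof.
move=> [x Ax] lf fg; apply: lb_le_inf; first by exists (g x), x.
move=> _ [y Ay <-]; rewrite (le_trans _ (fg y Ay))//.
by apply: ge_inf => //; exists y.
Qed.

Lemma le_sup_image (R : realType) (T : Type) (A : set T) (f g : T -> R) :
  has_ubound (g @` A) -> (forall x, A x -> f x <= g x) ->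
  sup (f @` A) <= sup (g @` A).
Proof.
move=> ug fg; have [A0|nA] := pselect (A !=set0); last first.
  suff -> : A = set0 by rewrite !image_set0.
  by apply/seteqP; split=> // x Ax; apply: nA; exists x.
case: A0 => x Ax; apply: ge_sup; first by exists (f x), x.
move=> _ [y Ay <-]; rewrite (le_trans (fg y Ay))//.
by apply: ub_le_sup => //; exists y.
Qed.

(** If the infimum does not exist, [inf] has the default value 0, which satisfies the bound too;
    likewise for [sup] below. *)
Lemma inf_image_le0 (R : realType) (T : Type) (A : set T) (f : T -> R) :
  (forall x, A x -> f x <= 0) -> inf (f @` A) <= 0.
Proof.
move=> f0; have [[[_ [x Ax _]] lf]|/inf_out ->//] := pselect (has_inf (f @` A)).
by rewrite (le_trans _ (f0 _ Ax))//; apply: ge_inf => //; exists x.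
Qed.

Lemma sup_image_le0 (R : realType) (T : Type) (A : set T) (f : T -> R) :
  (forall x, A x -> f x <= 0) -> sup (f @` A) <= 0.
Proof.
move=> f0; have [[nf _]|/sup_out ->//] := pselect (has_sup (f @` A)).
by apply: ge_sup => // _ [x Ax <-]; exact: f0.
Qed.

Lemma enormZ (R : realType) (N : nat) (a : R) (x : 'rV[R]_N) :
  enorm (a *: x) = `|a| * enorm x.
Proof.
rewrite /enorm -sqrtr_sqr -sqrtrM ?sqr_ge0// mulr_sumr; congr Num.sqrt.
by apply: eq_bigr => i _; rewrite mxE exprMn.
Qed.

Lemma enorm_eq0 (R : realType) (N : nat) (x : 'rV[R]_N) : enorm x = 0 -> x = 0.
Proof.
move=> /eqP; rewrite sqrtr_eq0 => x0; apply/rowP => i; rewrite mxE.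
apply/eqP; rewrite -sqrf_eq0 eq_le sqr_ge0 andbT (le_trans _ x0)//.
by rewrite (bigD1 i)//= lerDl sumr_ge0// => j _; exact: sqr_ge0.
Qed.

Definition unit_sphere (R : realType) (N : nat) (S : {vspace 'rV[R]_N}) :
  set 'rV[R]_N := [set z : 'rV[R]_N | z \in S /\ enorm z = 1].

Lemma unit_sphere_nonempty (R : realType) (N : nat) (S : {vspace 'rV[R]_N}) :
  (0 < \dim S)%N -> unit_sphere S !=set0.
Proof.
move=> S0; have v0 : vpick S != 0 by rewrite vpick0 -dimv_eq0 -lt0n.
exists ((enorm (vpick S))^-1 *: vpick S); split.
  by rewrite memvZ// memv_pick.
have e0 : enorm (vpick S) != 0 by apply: contra_neq v0 => /enorm_eq0.
by rewrite enormZ ger0_norm ?invr_ge0 ?sqrtr_ge0// mulVf.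
Qed.

Lemma unit_sphere_fullv (R : realType) (N : nat) :
  unit_sphere fullv = [set z : 'rV[R]_N | enorm z = 1].
Proof. by apply/seteqP; split=> z /=; [case|split; first exact: memvf]. Qed.

(** The Courant-Fischer expression for an arbitrary function of the direction; [k = N - i + 1] gives
    the term of index [i] in [E_trace]. *)
Definition maxmin (R : realType) (N : nat) (f : 'rV[R]_N -> R) (k : nat) : R :=
  sup [set inf (f @` unit_sphere S) | S in [set S | \dim S = k]].

Lemma dim_fullv_rV (R : realType) (N : nat) :
  \dim (fullv : {vspace 'rV[R]_N}) = N.
Proof. by rewrite dimvf; exact: mul1n. Qed.

Lemma maxmin_full (R : realType) (N : nat) (f : 'rV[R]_N -> R) :
  maxmin f N = inf (f @` [set z | enorm z = 1]).
Proof.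
rewrite /maxmin -unit_sphere_fullv.
rewrite (_ : [set S | \dim S = N] = [set fullv]).
  by rewrite image_set1 sup1.
apply/seteqP; split=> [S /= dS|_ ->]; last exact: dim_fullv_rV.
by apply/eqP; rewrite eqEdim subvf dim_fullv_rV dS/=.
Qed.

(** Monotonicity of total [sup] and [inf] requires genuine extrema: [K] bounds the values and
    [0 < k] makes every unit sphere nonempty. *)
Lemma le_maxmin (R : realType) (N : nat) (K : R) (f g : 'rV[R]_N -> R)
    (k : nat) : (0 < k)%N ->
  (forall z, enorm z = 1 -> `|f z| <= K) ->
  (forall z, enorm z = 1 -> `|g z| <= K) ->
  (forall z, enorm z = 1 -> f z <= g z) -> maxmin f k <= maxmin g k.
Proof.
move=> k0 fK gK fg.
have sphere_lb (h : 'rV[R]_N -> R) (S : {vspace 'rV[R]_N}) :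
    (forall z, enorm z = 1 -> `|h z| <= K) ->
    lbound (h @` unit_sphere S) (- K).
  by move=> hK _ [z [_ /hK]] + <-; rewrite ler_norml => /andP[].
apply: le_sup_image.
- exists K => _ [S dS <-].
  have [z Sz] : unit_sphere S !=set0 by apply: unit_sphere_nonempty; rewrite dS.
  apply: (@le_trans _ _ (g z)).
    by apply: ge_inf; [exists (- K); exact: sphere_lb|exists z].
  by case: Sz => _ /gK; rewrite ler_norml => /andP[].
- move=> S dS; apply: le_inf_image.
  + by apply: unit_sphere_nonempty; rewrite dS.
  + by exists (- K); exact: sphere_lb.
  + by move=> z [_ /fg].
Qed.

(** Either operator as a functional of the directional values alone, so that the two problems share
    one proof. *)
Definition problem_op (p : problem) (R : realType) (N : nat)
    (f : 'rV[R]_N -> R) : R :=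
  match p with
  | Trace => - \sum_(1 <= i < N.+1) maxmin f (N - i + 1)
  | Midrange => - (inf (f @` [set z | enorm z = 1])
                   + sup (f @` [set z | enorm z = 1]))
  end.

Lemma E_problemE (p : problem) (R : realType) (N : nat) (s d : R)
    (w phi : 'rV[R]_N -> R) (x : 'rV[R]_N) :
  E_problem p s d w phi x = problem_op p (fun z => E_dir s z d w phi x).
Proof. by case: p. Qed.

(** The index 1 corresponds to dimension [N], where the whole space is the only subspace. The trace
    operator thus has the shape of the mid-range one: an infimum over all directions plus a monotone
    remainder. *)
Lemma sum_maxmin_recl (R : realType) (N : nat) (f : 'rV[R]_N -> R) :
  (0 < N)%N ->
  \sum_(1 <= i < N.+1) maxmin f (N - i + 1) =
  inf (f @` [set z | enorm z = 1]) +
  \sum_(2 <= i < N.+1) maxmin f (N - i + 1).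
Proof. by move=> N0; rewrite big_ltn// subnK// maxmin_full. Qed.

Lemma enorm1_nonempty (R : realType) (N : nat) : (0 < N)%N ->
  [set z : 'rV[R]_N | enorm z = 1] !=set0.
Proof.
move=> N0; rewrite -unit_sphere_fullv; apply: unit_sphere_nonempty.
by rewrite dim_fullv_rV.
Qed.

Lemma inf_image_shift (R : realType) (N : nat) (K c : R) (f g : 'rV[R]_N -> R) :
  (0 < N)%N -> (forall z, enorm z = 1 -> `|f z| <= K) ->
  (forall z, enorm z = 1 -> f z <= g z - c) ->
  inf (f @` [set z | enorm z = 1]) <= inf (g @` [set z | enorm z = 1]) - c.
Proof.
move=> N0 fK fg; rewrite lerBrDr; have [z0 z01] := enorm1_nonempty R N0.
apply: lb_le_inf; first by exists (g z0), z0.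
move=> _ [z z1 <-]; rewrite -lerBrDr (le_trans _ (fg z z1))//.
apply: ge_inf; last by exists z.
by exists (- K) => _ [y /fK + <-]; rewrite ler_norml => /andP[].
Qed.

(** The infimum over all directions drops by at least [c], while the remaining terms are monotone
    and cannot make up for it. *)
Lemma problem_op_lt (p : problem) (R : realType) (N : nat) (K c : R)
    (f g : 'rV[R]_N -> R) : (0 < N)%N -> 0 < c ->
  (forall z, enorm z = 1 -> `|f z| <= K) ->
  (forall z, enorm z = 1 -> `|g z| <= K) ->
  (forall z, enorm z = 1 -> f z <= g z - c) ->
  problem_op p g < problem_op p f.
Proof.
move=> N0 c0 fK gK fg.
have fg' z : enorm z = 1 -> f z <= g z.
  by move=> /fg h; rewrite (le_trans h)// gerBl ltW.
have fg_inf := inf_image_shift N0 fK fg.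
case: p => /=; rewrite ltrN2.
  rewrite !sum_maxmin_recl//; apply: ltr_leD.
    by rewrite (le_lt_trans fg_inf)// gtrBl.
  by apply: ler_sum => i _; apply: (@le_maxmin R N K) => //; rewrite addn1.
apply: ltr_leD; first by rewrite (le_lt_trans fg_inf)// gtrBl.
apply: le_sup_image => //.
by exists K => _ [y /gK + <-]; rewrite ler_norml => /andP[].
Qed.

(** The terms other than the infimum are nonpositive, so the inequality pushes the infimum over
    directions up to at least 0, and every directional value is squeezed to 0. *)
Lemma problem_op_le0 (p : problem) (R : realType) (N : nat) (K : R)
    (f : 'rV[R]_N -> R) : (0 < N)%N ->
  (forall z, enorm z = 1 -> `|f z| <= K) ->
  (forall z, enorm z = 1 -> f z <= 0) -> problem_op p f <= 0 ->
  forall z, enorm z = 1 -> f z = 0.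
Proof.
move=> N0 fK f0 pf z z1.
suff inf0 : 0 <= inf (f @` [set z | enorm z = 1]).
  apply/eqP; rewrite eq_le f0//= (le_trans inf0)//.
  apply: ge_inf; last by exists z.
  by exists (- K) => _ [y /fK + <-]; rewrite ler_norml => /andP[].
case: p pf => /=; rewrite oppr_le0.
  rewrite sum_maxmin_recl// => h; rewrite (le_trans h)// gerDl sumr_le0// => i _.
  by apply: sup_image_le0 => S _; apply: inf_image_le0 => y [_ /f0].
by move=> h; rewrite (le_trans h)// gerDl; exact: sup_image_le0.
Qed.

(** * Topology of the row space *)

(** The difference quotient is exactly [a + b * h]. *)
Lemma is_derive_quadratic (R : realType) (V : normedModType R) (f : V -> R)
    (x v : V) (a b : R) :
  (forall h : R, f (x + h *: v) - f x = a * h + b * h ^+ 2) ->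
  is_derive x v f a.
Proof.
move=> fE.
have cv : h^-1 *: ((f \o shift x) (h *: v) - f x) @[h --> 0^'] --> a.
  apply: (@cvg_trans _ ((fun h : R => a + b * h) @ 0^')).
    apply: near_eq_cvg; near=> h.
    have h0 : h != 0 by near: h; exact: nbhs_dnbhs_neq.
    rewrite /= [h *: v + x]addrC fE /GRing.scale/=.
    by field.
  have : (fun h : R => a + b * h) @ 0^' --> a + b * 0.
    apply: cvgD; first exact: cvg_cst.
    by apply: cvgMr; exact: nbhs_dnbhs.
  by rewrite mulr0 addr0.
by split; [apply/cvg_ex; exists a|exact: cvg_lim cv].
Unshelve. all: by end_near. Qed.

Lemma continuous_coord (R : realType) (N : nat) (i : 'I_N) :
  continuous (fun x : 'rV[R]_N => x 0 i).
Proof. by move=> x; exact: coord_continuous. Qed.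

Lemma continuous_coordB (R : realType) (N : nat) (i : 'I_N) (c : R) :
  continuous (fun x : 'rV[R]_N => x 0 i - c).
Proof.
move=> x; apply: (@continuous_comp _ _ _ (fun x : 'rV[R]_N => x 0 i)
  (fun t : R => t - c)); first exact: continuous_coord.
by apply: cvgB; [exact: cvg_id|exact: cvg_cst].
Qed.

Lemma continuous_paraboloid (R : realType) (N : nat) (c k : R) (y : 'rV[R]_N) :
  continuous (paraboloid c k y).
Proof.
have cs : continuous (fun x : 'rV[R]_N => \sum_(i < N) (x 0 i - y 0 i) ^+ 2).
  apply: continuous_big => [|i _ x]; first exact: add_continuous.
  apply: (@continuous_comp _ _ _ (fun x : 'rV[R]_N => x 0 i - y 0 i)
    (fun t : R => t ^+ 2)); last exact: exprn_continuous.
  exact: continuous_coordB.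
move=> x; apply: (@continuous_comp _ _ _ _ (fun t : R => c + k * t)).
  exact: cs.
apply: cvgD; first exact: cvg_cst.
by apply: cvgMr; exact: cvg_id.
Qed.

Lemma enorm_delta_mx (R : realType) (N : nat) (i : 'I_N) :
  enorm (delta_mx 0 i : 'rV[R]_N) = 1.
Proof.
rewrite /enorm (bigD1 i)//= big1 => [|j ji]; rewrite !mxE !eqxx/=.
  by rewrite expr1n addr0 sqrtr1.
by rewrite (negbTE ji) expr0n.
Qed.

Lemma is_derive_paraboloid (R : realType) (N : nat) (c k : R) (y x : 'rV[R]_N)
    (i : 'I_N) :
  is_derive x (delta_mx 0 i) (paraboloid c k y) (2 * k * (x 0 i - y 0 i)).
Proof.
apply: (@is_derive_quadratic _ _ _ _ _ _ k) => h.
rewrite paraboloid_line ?enorm_delta_mx//.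
congr (_ * _ * _ + _); rewrite (bigD1 i)//= big1 => [|j ji];
  rewrite !mxE !eqxx/=.
  by rewrite mulr1 addr0.
by rewrite (negbTE ji) mulr0.
Qed.

Lemma C2_paraboloid (R : realType) (N : nat) (c k : R) (y : 'rV[R]_N) :
  C2 (paraboloid c k y).
Proof.
have pE i : partial i (paraboloid c k y) = fun x => 2 * k * (x 0 i - y 0 i).
  by apply/funext => x; rewrite /partial; have [] := is_derive_paraboloid c k y x i.
have cp (i : 'I_N) : continuous (fun x : 'rV[R]_N => 2 * k * (x 0 i - y 0 i)).
  move=> x; apply: (@continuous_comp _ _ _ (fun x : 'rV[R]_N => x 0 i - y 0 i)
    (fun t : R => 2 * k * t)).
    exact: continuous_coordB.
  by apply: cvgMr; exact: cvg_id.
have dp (i j : 'I_N) x : is_derive x (delta_mx 0 j)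
    (fun x : 'rV[R]_N => 2 * k * (x 0 i - y 0 i)) (2 * k * (i == j)%:R).
  apply: (@is_derive_quadratic _ _ _ _ _ _ 0) => h.
  by rewrite !mxE eqxx/=; ring.
split; first exact: continuous_paraboloid.
- move=> i; split; last by rewrite pE.
  by move=> x; have [] := is_derive_paraboloid c k y x i.
- move=> i j; rewrite pE; split; first by move=> x; have [] := dp i j x.
  rewrite (_ : partial _ _ = cst (2 * k * (i == j)%:R)).
    exact: cst_continuous.
  by apply/funext => x; rewrite /partial; have [] := dp i j x.
Qed.

(** * Sup norm against Euclidean norm *)

Lemma norm_coord_le (R : realType) (N : nat) (x : 'rV[R]_N) (i : 'I_N) :
  `|x 0 i| <= `|x|.
Proof.
by rewrite [leRHS]/Num.norm/= mx_normrE; 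
  apply: (le_bigmax _ (fun ij => `|x ij.1 ij.2|) (0, i)).
Qed.

Lemma norm_le_coord (R : realType) (N : nat) (x : 'rV[R]_N) (r : R) :
  0 <= r -> (forall i, `|x 0 i| <= r) -> `|x| <= r.
Proof.
move=> r0 xr; rewrite [leLHS]/Num.norm/= mx_normrE.
by apply/bigmax_leP; split=> // -[i j] _ /=; rewrite ord1.
Qed.

Lemma norm_le_enorm (R : realType) (N : nat) (x : 'rV[R]_N) : `|x| <= enorm x.
Proof.
apply: norm_le_coord => [|i]; first exact: sqrtr_ge0.
rewrite -sqrtr_sqr ler_wsqrtr// (bigD1 i)//= lerDl sumr_ge0// => j _.
exact: sqr_ge0.
Qed.

(** Coordinates of a Euclidean unit vector have modulus at most 1, so each square is at most the
    modulus, hence at most the sup norm. *)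
Lemma enorm_le_norm (R : realType) (N : nat) (x : 'rV[R]_N) :
  enorm x = 1 -> 1 <= N%:R * `|x|.
Proof.
move=> x1; rewrite -[leLHS](sum_sqr_enorm1 x1).
have xle1 : `|x| <= 1 by rewrite -x1 norm_le_enorm.
apply: (@le_trans _ _ (\sum_(i < N) `|x|)); last first.
  by rewrite sumr_const card_ord mulr_natl.
apply: ler_sum => i _; rewrite -real_normK ?num_real//.
rewrite (le_trans _ (norm_coord_le x i))// expr2 ler_piMl//.
exact: le_trans (norm_coord_le x i) xle1.
Qed.

Lemma continuous_fst_comp (U V W : topologicalType) (h : U -> W) :
  continuous h -> continuous (fun q : U * V => h q.1).
Proof.
move=> ch q; apply: (@continuous_comp _ _ _ fst h); last exact: ch.
exact: cvg_fst.
Qed.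

Lemma continuous_snd_comp (U V W : topologicalType) (h : V -> W) :
  continuous h -> continuous (fun q : U * V => h q.2).
Proof.
move=> ch q; apply: (@continuous_comp _ _ _ snd h); last exact: ch.
exact: cvg_snd.
Qed.

(** The pairs in [K] whose values differ by at least [e] form a compact set off the diagonal; the
    least distance over that set serves as [r]. *)
Lemma compact_uniformly_continuous (R : realType) (N : nat) (K : set 'rV[R]_N)
    (u : 'rV[R]_N -> R) (e : R) : compact K -> continuous u -> 0 < e ->
  exists2 r, 0 < r &
    forall x y, K x -> K y -> `|x - y| < r -> `|u x - u y| < e.
Proof.
move=> cK cu e0.
pose g (p : 'rV[R]_N * 'rV[R]_N) := `|u p.1 - u p.2|.
pose A := (K `*` K) `&` (g @^-1` [set t | e <= t]).
have cg : continuous g.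
  move=> p; apply: cvg_norm; apply: cvgB; 
    [exact: continuous_fst_comp|exact: continuous_snd_comp].
have cA : compact A.
  apply: compact_closedI; first exact: compact_setX.
  by apply: preimage_closed => [p _|]; [exact: cg|exact: closed_ge].
have [A0|nA] := pselect (A !=set0); last first.
  exists 1 => // x y Kx Ky _; rewrite ltNge; apply/negP => exy.
  by apply: nA; exists (x, y).
have cd : continuous (fun p : 'rV[R]_N * 'rV[R]_N => `|p.1 - p.2|).
  move=> p; apply: cvg_norm; apply: cvgB; [exact: cvg_fst|exact: cvg_snd].
have [p /set_mem [_ gp] pmin] := compact_EVT_min A0 cA (continuous_subspaceT cd).
exists `|p.1 - p.2|.
  rewrite normr_gt0 subr_eq0; apply/eqP => pp.
  by move: gp; rewrite /g/= pp subrr normr0 leNgt e0.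
move=> x y Kx Ky; rewrite ltNge; apply: contraNlt => exy.
by apply: (pmin (x, y)); rewrite inE.
Qed.

Lemma semicontinuous_continuous (R : realType) (T : topologicalType)
    (u : T -> R) :
  upper_semicontinuous u -> lower_semicontinuous (EFin \o u) -> continuous u.
Proof.
move=> us ls x; apply/cvgrPdist_lt => e e0; near=> y.
have h1 : u y < u x + e by near: y; apply: us; rewrite ltrDl.
have h2 : u x - e < u y.
  near: y; have [|V Vx Vu] := ls x (u x - e).
    by rewrite lte_fin gtrBl.
  by near=> y; rewrite -lte_fin; apply: Vu; near: y.
by rewrite ltr_norml; apply/andP; split; lra.
Unshelve. all: by end_near. Qed.

Lemma continuous_col' (R : realType) (N : nat) (j : 'I_N) :
  continuous (fun x : 'rV[R]_N => col' j x).
Proof.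
move=> x; apply/(@cvgrPdist_le _ _ _ _ (nbhs_filter x)) => e e0.
near=> y.
apply: norm_le_coord => [|i]; first exact: ltW.
have := norm_coord_le (x - y) (lift j i); rewrite !mxE => /le_trans; apply.
near: y; apply/nbhs_ballP; exists e => // y; rewrite -ball_normE/=; exact: ltW.
Unshelve. all: by end_near. Qed.

Lemma continuous_enorm (R : realType) (N : nat) : continuous (@enorm R N).
Proof.
move=> x; apply: (@continuous_comp _ _ _
  (fun x : 'rV[R]_N => \sum_(i < N) x 0 i ^+ 2)).
  apply: continuous_big => [|i _ y]; first exact: add_continuous.
  apply: (@continuous_comp _ _ _ (fun x : 'rV[R]_N => x 0 i)
    (fun t : R => t ^+ 2)); last exact: exprn_continuous.
  exact: continuous_coord.
exact: sqrt_continuous.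
Qed.

Lemma open_eball (R : realType) (N : nat) (x : 'rV[R]_N) (r : R) :
  open (eball x r).
Proof.
rewrite (_ : eball x r = (fun y => enorm (y - x)) @^-1` [set t | t < r])//.
apply: open_comp; last exact: open_lt.
move=> y _; apply: (@continuous_comp _ _ _ (fun y : 'rV[R]_N => y - x)
  (@enorm R N)); last exact: continuous_enorm.
by apply: (cvgB (FF := nbhs_filter y)); [exact: cvg_id|exact: cvg_cst].
Qed.

Lemma compact_norm_le (R : realType) (N : nat) (r : R) :
  compact [set x : 'rV[R]_N | `|x| <= r].
Proof.
apply: bounded_closed_compact.
  exists r; split; first exact: num_real.
  by move=> b /ltW hb x /= /le_trans; apply.
apply: (@closed_comp _ _ (fun x : 'rV[R]_N => `|x|) [set t | t <= r]).
  by move=> x _; exact: norm_continuous.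
exact: closed_le.
Qed.

(** * Exterior points near the boundary of a C^2 domain *)

(** A boundary point lies on or below the local graph, and a small downward shift along the graph
    axis lands strictly below it, away from the closure of the domain. *)
Lemma boundary_limit_exterior (R : realType) (N : nat) (Omega : set 'rV[R]_N)
    (x0 : 'rV[R]_N) : open Omega -> C2_boundary Omega -> boundary Omega x0 ->
  closure (~` closure Omega) x0.
Proof.
move=> oO bO bx0; have [r [gamma [j [b [r0 [cg _ _] gE]]]]] := bO _ bx0.
pose sg : R := (-1) ^+ b.
have sgsg : sg * sg = 1 by rewrite -expr2 sqrr_sign.
have nsg : `|sg| = 1 by rewrite normrX normrN1 expr1n.
have x0x0 : eball x0 r x0.
  rewrite /eball/= subrr (_ : enorm 0 = 0)//.
  by rewrite -(scale0r 0) enormZ normr0 mul0r.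
have gx0 : sg * x0 0 j <= gamma (col' j x0).
  rewrite leNgt; apply/negP => /(proj2 (gE _ x0x0)) Ox0.
  by case: bx0 => _; rewrite (interior_id _).1.
move=> V /nbhs_ballP[e /= e0 eV].
(* The shift must stay both in the given neighbourhood and in the chart. *)
pose h := Num.min e r / 2.
have h0 : 0 < h by rewrite divr_gt0// lt_min e0 r0.
have he : h < e.
  rewrite ltr_pdivrMr// (@le_lt_trans _ _ e) ?ge_min ?lexx//.
  by rewrite ltr_pMr// ltr1n.
have hr : h < r.
  rewrite ltr_pdivrMr// (@le_lt_trans _ _ r) ?ge_min ?lexx ?orbT//.
  by rewrite ltr_pMr// ltr1n.
pose y : 'rV[R]_N := x0 - (h * sg) *: delta_mx 0 j.
have yx0 : enorm (y - x0) = h.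
  rewrite /y addrC addKr -scaleNr enormZ enorm_delta_mx mulr1 normrN normrM.
  by rewrite nsg mulr1 gtr0_norm.
have cy : col' j y = col' j x0.
  apply/rowP => i; rewrite !mxE (_ : lift j i == j = false) ?andbF ?mulr0 ?subr0//.
  by apply/negbTE; rewrite eq_sym neq_lift.
have yj : sg * y 0 j = sg * x0 0 j - h.
  by rewrite !mxE !eqxx/= mulr1 mulrBr mulrCA sgsg mulr1.
exists y; split; last first.
  apply: eV; rewrite -ball_normE/= distrC (le_lt_trans (norm_le_enorm _))//.
  by rewrite yx0.
(* The open part of the chart strictly below the graph: it contains [y] and misses [Omega], so [y]
   is outside the closure. *)
pose W := eball x0 r `&`
  (fun x => gamma (col' j x) - sg * x 0 j) @^-1` [set t | 0 < t].
have oW : open W.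
  apply: openI; first exact: open_eball.
  apply: open_comp; last exact: open_gt.
  move=> x _; apply: (cvgB (FF := nbhs_filter x)).
    apply: (@continuous_comp _ _ _ (fun x : 'rV[R]_N => col' j x) gamma).
      exact: continuous_col'.
    exact: cg.
  apply: (@continuous_comp _ _ _ (fun x : 'rV[R]_N => x 0 j) (fun t => sg * t)).
    exact: continuous_coord.
  by apply: cvgMr; exact: cvg_id.
have Wy : W y.
  split; first by rewrite /eball/= yx0.
  by rewrite /= cy yj; lra.
move=> /(_ W (open_nbhs_nbhs (conj oW Wy)))[x [Ox [xr xg]]].
by move: xg; rewrite /= subr_gt0 ltNge ltW//; exact/(gE _ xr).1.
Qed.

(** At a boundary point a violation would persist, by continuity relative to the complement, at
    nearby exterior points, where the bound is assumed. *)
Lemma le_on_complement (R : realType) (N : nat) (Omega : set 'rV[R]_N)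
    (h : 'rV[R]_N -> R) (M : R) : open Omega -> C2_boundary Omega ->
  {within ~` Omega, continuous h} ->
  (forall x, (~` closure Omega) x -> h x <= M) ->
  forall x, (~` Omega) x -> h x <= M.
Proof.
move=> oO bO ch hM x Ox; have [cx|/hM//] := pselect (closure Omega x).
have bx : boundary Omega x by split=> //; rewrite (interior_id _).1.
rewrite leNgt; apply/negP => Mh.
have := ch x.
rewrite /continuous_at => /(_ _ (open_nbhs_nbhs (conj (@open_gt _ M) Mh))).
rewrite /= nbhs_simpl/= => /(nbhs_subspace_ex _ Ox)[V Vx VE].
have [y [yO Vy]] := boundary_limit_exterior oO bO bx Vx.
have nOy : (~` Omega) y by move=> /(@subset_closure _ Omega).
have [+ _] : ((h @^-1` [set t | M < t]) `&` ~` Omega) y by rewrite VE.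
by rewrite /= ltNge hM.
Qed.

Lemma upper_ext_id (R : realType) (N : nat) (Omega : set 'rV[R]_N)
    (g u : 'rV[R]_N -> R) : (forall x, (~` Omega) x -> u x = g x) ->
  upper_ext Omega g u = u.
Proof.
move=> ug; apply/funext => x; rewrite /upper_ext.
case: ifPn => // /negP; rewrite inE => /ug ->.
by case: ifPn => // _; rewrite maxxx.
Qed.

Lemma lower_ext_id (R : realType) (N : nat) (Omega : set 'rV[R]_N)
    (g u : 'rV[R]_N -> R) : (forall x, (~` Omega) x -> u x = g x) ->
  lower_ext Omega g u = u.
Proof.
move=> ug; apply/funext => x; rewrite /lower_ext.
case: ifPn => // /negP; rewrite inE => /ug ->.
by case: ifPn => // _; rewrite minxx.
Qed.

(** * Comparison *)

(** The interior test condition with [u] in place of its extension, the form available once [u]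
    agrees with its datum off [Omega]. *)
Definition interior_subsolution (p : problem) (R : realType) (N : nat) (s : R)
    (Omega : set 'rV[R]_N) (u : 'rV[R]_N -> R) : Prop :=
  forall (d : R) (phi : 'rV[R]_N -> R) (x0 : 'rV[R]_N), 0 < d -> C2 phi ->
    (forall y, eball x0 d y -> u y - phi y <= u x0 - phi x0) ->
    Omega x0 -> E_problem p s d u phi x0 <= 0.

Definition interior_supersolution (p : problem) (R : realType) (N : nat) (s : R)
    (Omega : set 'rV[R]_N) (u : 'rV[R]_N -> R) : Prop :=
  forall (d : R) (phi : 'rV[R]_N -> R) (x0 : 'rV[R]_N), 0 < d -> C2 phi ->
    (forall y, eball x0 d y -> u x0 - phi x0 <= u y - phi y) ->
    Omega x0 -> 0 <= E_problem p s d u phi x0.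

Lemma small_tail (R : realType) (p a A e : R) : 0 < p -> 0 < e ->
  exists2 T, a <= T & A * (p^-1 * T `^ (- p)) <= e.
Proof.
move=> p0 e0.
have h : A * (p^-1 * T `^ (- p)) @[T --> +oo] --> A * (p^-1 * 0).
  by apply: cvgMr; apply: cvgMr; exact: powRN_cvg0.
have /filter_ex[T [aT hT]] :
    \forall T \near +oo, a <= T /\ A * (p^-1 * T `^ (- p)) <= e.
  near=> T; split; first by near: T; exact: (nbhs_pinfty_ge (num_real a)).
  by near: T; apply: (cvgr_le _ h); rewrite !mulr0.
by exists T.
Unshelve. all: by end_near. Qed.

Lemma small_core (R : realType) (p A e : R) : 0 < p -> 0 < e ->
  exists d, [/\ 0 < d, d <= 1 & A * d `^ p <= e].
Proof.
move=> p0 e0.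
have h : A * d `^ p @[d --> 0^'+] --> A * 0 by apply: cvgMr; exact: powR_cvg0.
have /filter_ex[d hd] : \forall d \near 0^'+, [/\ 0 < d, d <= 1 & A * d `^ p <= e].
  near=> d; split; [near: d; exact: nbhs_right_gt|near: d; exact: nbhs_right_le|].
  by near: d; apply: (cvgr_le _ h); rewrite !mulr0.
by exists d.
Unshelve. all: by end_near. Qed.

(** The vector [t *: z] is a difference of two points of the sup-norm ball; the factor [N] converts
    the Euclidean normalization of [z]. *)
Lemma line_leaves_bounded_set (R : realType) (N : nat) (rho t : R)
    (x z : 'rV[R]_N) : enorm z = 1 -> `|x| <= rho -> `|x + t *: z| <= rho ->
  `|t| <= N%:R * (2 * rho).
Proof.
move=> z1 xr xtr.
have h : `|t| * `|z| <= 2 * rho.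
  rewrite -normrZ -[t *: z](addKr x) addrC (le_trans (ler_normB _ _))//.
  by rewrite (_ : 2 * rho = rho + rho) ?lerD//; ring.
apply: (@le_trans _ _ (N%:R * (`|t| * `|z|))); last by rewrite ler_wpM2l.
by rewrite mulrCA ler_peMr// enorm_le_norm.
Qed.

(** The shift [M] lets one doubling argument serve both comparison, with [M = 0], and continuous
    dependence, with [M] a bound for the difference of the data. *)
Lemma comparison_interior (R : realType) (N : nat) (p : problem) (s C M : R)
    (Omega : set 'rV[R]_N) (u1 u2 : 'rV[R]_N -> R) :
  (0 < N)%N -> 0 < s -> s < 1 -> bounded_set Omega ->
  continuous u1 -> continuous u2 ->
  (forall x, `|u1 x| <= C) -> (forall x, `|u2 x| <= C) ->
  interior_supersolution p s Omega u1 -> interior_subsolution p s Omega u2 ->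
  (forall x, (~` Omega) x -> u2 x <= u1 x + M) ->
  forall x, Omega x -> u2 x <= u1 x + M.
Proof.
move=> N0 s0 s1 [r0 [_ bO]] c1 c2 u1C u2C sup1 sub2 out x0 Ox0.
rewrite leNgt; apply/negP => x0M.
pose rho := `|r0| + 1.
have rho0 : 0 < rho by rewrite ltr_wpDl.
have Or x : Omega x -> `|x| <= rho.
  by apply: bO; rewrite /rho (le_lt_trans (ler_norm _))// ltrDl.
(* The excess is [2 * m]: one [m] is spent on moving between [x] and [y], the other is the gap kept
   outside [Omega]. *)
pose m := (u2 x0 - u1 x0 - M) / 2.
have m0 : 0 < m by rewrite divr_gt0//; lra.
have mE : u2 x0 - u1 x0 = M + 2 * m by rewrite /m; field.
have C0 : 0 <= C by exact: le_trans (u1C x0).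
(* From this length on a line started in [Omega] has strictly left it; the added 1 also ensures
   [d <= a]. *)
pose a := N%:R * (2 * rho) + 1.
have a1 : 1 <= a by rewrite lerDr !mulr_ge0// ltW.
pose I r := s^-1 * r `^ (- (2 * s)).
have Ia0 : 0 < I a by rewrite mulr_gt0 ?invr_gt0// powR_gt0// (lt_le_trans _ a1).
(* Of the gain [m * I a], half pays for the tail beyond [T], a quarter will pay for the local part,
   and a quarter is left as strict margin. The order of choices is [T], then [k], then [d]. *)
have [T aT hT] : exists2 T, a <= T & (m + 4 * C) * I T <= m * I a / 2.
  have [||T aT hT] := @small_tail R (2 * s) a (2 * (m + 4 * C)) (m * I a / 2).
  - by rewrite mulr_gt0.
  - by rewrite divr_gt0// mulr_gt0.
  exists T => //; rewrite (le_trans _ hT)// /I.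
  rewrite le_eqVlt; apply/orP; left; apply/eqP.
  by field; rewrite gt_eqF.
have T0 : 0 <= T by lra.
(* Large enough for segments of length [T] and for balls of radius [d <= 1] started in [Omega]. *)
pose K := [set x : 'rV[R]_N | `|x| <= rho + T + 1].
have cK : compact K by exact: compact_norm_le.
have OK x : Omega x -> K x by move=> /Or; rewrite /K/=; lra.
have [r1 r10 h1] := compact_uniformly_continuous cK c1 m0.
have [r2 r20 h2] := compact_uniformly_continuous cK c2 m0.
pose r := Num.min r1 r2.
have rgt0 : 0 < r by rewrite lt_min r10.
(* Comparing the maximum with the value at [(x0, x0)] bounds the penalty by [4 * C], so this [k]
   forces [x] and [y] within [r] of each other. *)
pose k := (4 * C + 1) / r ^+ 2.
have k0 : 0 < k by rewrite divr_gt0 ?exprn_gt0//; lra.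
pose D (x y : 'rV[R]_N) := \sum_(i < N) (x 0 i - y 0 i) ^+ 2.
have D0 x y : 0 <= D x y by apply: sumr_ge0 => i _; exact: sqr_ge0.
pose F (q : 'rV[R]_N * 'rV[R]_N) := u2 q.1 - u1 q.2 - k * D q.1 q.2.
have cF : continuous F.
  have cD : continuous (fun q : 'rV[R]_N * 'rV[R]_N => D q.1 q.2).
    apply: continuous_big => [|i _ q]; first exact: add_continuous.
    apply: (@continuous_comp _ _ _
      (fun q : 'rV[R]_N * 'rV[R]_N => q.1 0 i - q.2 0 i)
      (fun t : R => t ^+ 2)); last exact: exprn_continuous.
    apply: cvgB.
      exact: (@continuous_fst_comp _ _ _ (fun x : 'rV[R]_N => x 0 i)
        (@continuous_coord R N i)).
    exact: (@continuous_snd_comp _ _ _ (fun x : 'rV[R]_N => x 0 i)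
      (@continuous_coord R N i)).
  move=> q; apply: cvgB; last by apply: cvgMr; exact: cD.
  by apply: cvgB; 
    [exact: continuous_fst_comp|exact: continuous_snd_comp].
have KK0 : (K `*` K) !=set0 by exists (x0, x0); split; exact: OK.
have [[x y] /set_mem [/= Kx Ky] Fmax] :=
  compact_EVT_max KK0 (compact_setX cK cK) (continuous_subspaceT cF).
have {}Fmax x' y' : K x' -> K y' ->
    u2 x' - u1 y' - k * D x' y' <= u2 x - u1 y - k * D x y.
  by move=> Kx' Ky'; apply: (Fmax (x', y')); rewrite inE.
have Fxy : M + 2 * m <= u2 x - u1 y - k * D x y.
  rewrite (le_trans _ (Fmax x0 x0 (OK _ Ox0) (OK _ Ox0)))// mE.
  rewrite (_ : D x0 x0 = 0) ?mulr0 ?subr0//.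
  by apply: big1 => i _; rewrite subrr expr0n.
have kD0 : 0 <= k * D x y by rewrite mulr_ge0// ltW.
have xyr : `|x - y| < r.
  apply: (le_lt_trans (norm_le_enorm _)); rewrite /enorm.
  rewrite (_ : \sum_(i < N) _ = D x y); last first.
    by apply: eq_bigr => i _; rewrite !mxE.
  rewrite -(ger0_norm (ltW rgt0)) -sqrtr_sqr ltr_sqrt ?exprn_gt0//.
  rewrite -(ltr_pM2l k0) {2}/k divfK ?gt_eqF ?exprn_gt0//.
  have := u1C y; have := u2C x; have := u1C x0; have := u2C x0.
  by rewrite !ler_norml => /andP[? ?] /andP[? ?] /andP[? ?] /andP[? ?]; lra.
have u1xy x' y' : K x' -> K y' -> `|x' - y'| < r -> u1 x' < u1 y' + m.
  move=> Kx' Ky' h; have := h1 x' y' Kx' Ky'.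
  rewrite (lt_le_trans h) ?ge_min ?lexx// => /(_ isT).
  by rewrite ltr_norml => /andP[? ?]; lra.
have u2xy : u2 x < u2 y + m.
  have := h2 x y Kx Ky.
  rewrite (lt_le_trans xyr) ?ge_min ?lexx ?orbT// => /(_ isT).
  by rewrite ltr_norml => /andP[? ?]; lra.
(* If either point were outside [Omega], the exterior inequality and an error below [m] would
   contradict the excess [2 * m] at the maximum. *)
have Ox : Omega x.
  by apply: contrapT => /out; have := u1xy _ _ Kx Ky xyr; lra.
have Oy : Omega y by apply: contrapT => /out; lra.
have [d [d0 d1 hd]] : exists d,
    [/\ 0 < d, d <= 1 & 2 * k * ((1 - s)^-1 * d `^ (2 - 2 * s)) <= m * I a / 4].
  have [||d [d0 d1 hd]] :=
    @small_core R (2 - 2 * s) (2 * k * (1 - s)^-1) (m * I a / 4).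
  - by lra.
  - by rewrite divr_gt0// mulr_gt0.
  by exists d; split => //; rewrite mulrA.
have DN x' y' : D x' y' = D y' x'.
  by apply: eq_bigr => i _; rewrite -opprB sqrrN.
have Kball x' y' : Omega x' -> eball x' d y' -> K y'.
  move=> Ox'; rewrite /eball/= /K/= => h.
  have := Or _ Ox'; have := norm_le_enorm (y' - x').
  have := ler_normD x' (y' - x').
  by rewrite subrKC; lra.
(* Freezing one variable of the doubled maximum gives a paraboloid touching [u2] from above at [x],
   and one touching [u1] from below at [y], up to constants. *)
have := sub2 d (paraboloid 0 k y) x d0 (C2_paraboloid _ _ _) _ Ox.
rewrite E_problemE => E2.
have {}E2 := E2 _.
have := sup1 d (paraboloid 0 (- k) x) y d0 (C2_paraboloid _ _ _) _ Oy.
rewrite E_problemE => E1.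
have {}E1 := E1 _.
have [K1 hK1] := E_dir_bounded 0 (- k) y x s0 s1 d0 c1 u1C.
have [K2 hK2] := E_dir_bounded 0 k x y s0 s1 d0 c2 u2C.
suff : problem_op p (fun z => E_dir s z d u1 (paraboloid 0 (- k) x) y) <
       problem_op p (fun z => E_dir s z d u2 (paraboloid 0 k y) x).
  apply/negP; rewrite -leNgt; apply: le_trans (E2 _) (E1 _).
  - move=> y' /(Kball _ _ Ox) Ky'; have := Fmax _ _ Ky' Ky.
    by rewrite /paraboloid -!/(D _ _); lra.
  - move=> y' /(Kball _ _ Oy) Ky'; have := Fmax _ _ Kx Ky'.
    by rewrite /paraboloid -!/(D _ _) (DN y') (DN y); lra.
apply: (@problem_op_lt p R N (Num.max K1 K2) (m * I a / 4)) => //.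
- by rewrite divr_gt0// mulr_gt0.
- by move=> z z1; rewrite le_max hK2// orbT.
- by move=> z z1; rewrite le_max hK1.
move=> z z1.
have tz t : `|t *: z| <= `|t|.
  by rewrite normrZ ler_piMr// -z1 norm_le_enorm.
have Kt x' t : Omega x' -> `|t| <= T -> K (x' + t *: z).
  move=> /Or Ox' tT; rewrite /K/= (le_trans (ler_normD _ _))//.
  by have := tz t; lra.
(* Translating both points by the same vector leaves the penalty unchanged, so maximality compares
   the increments of [u2] at [x] and of [u1] at [y]. *)
have Dt t : D (x + t *: z) (y + t *: z) = D x y.
  by apply: eq_bigr => i _; rewrite !mxE; congr (_ ^+ 2); ring.
apply: le_trans (@E_dir_doubling R N s d a T m C 0 0 k u1 u2 x y z
  s0 s1 d0 (le_trans d1 a1) aT c1 c2 u1C u2C z1 _ _) _.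
- move=> t tT; have := Fmax _ _ (Kt _ _ Ox tT) (Kt _ _ Oy tT).
  by rewrite Dt; lra.
- move=> t /andP[at_ tT].
  have nO : (~` Omega) (x + t *: z).
    move=> /Or h; have := line_leaves_bounded_set z1 (Or _ Ox) h.
    by rewrite -/rho; move: at_; rewrite /a; lra.
  have := out _ nO; have := u1xy _ _ (Kt _ _ Ox tT) (Kt _ _ Oy tT).
  rewrite (_ : x + t *: z - (y + t *: z) = x - y); last first.
    by rewrite opprD addrACA subrr addr0.
  by move=> /(_ xyr); lra.
rewrite lerD2l -!/(I _); move: hd hT; set P := _ * (_ * _); lra.
Qed.

(** * Null sets *)

Lemma integral_indic_itv (R : realType) (r a b : R) : 0 <= r -> a <= b ->
  (\int[lebesgue_measure]_t (r * \1_(`[a, b]%classic) t)%:E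
   = (r * (b - a))%:E)%E.
Proof.
move=> r0 ab; under eq_integral do rewrite EFinM.
rewrite ge0_integralZl_EFin//; last first.
  by apply/measurable_EFinP; exact: measurable_indic.
rewrite integral_indic// setIT/= lebesgue_measure_itv/= lte_fin.
move: ab; rewrite le_eqVlt => /predU1P[->|->].
  by rewrite ltxx subrr mulr0 mule0.
by rewrite -EFinB -EFinM.
Qed.

(* Induction on the dimension, integrating out the last coordinate; the
   weights [c] and [ck] absorb the side lengths already integrated. *)
Lemma weighted_box_cover (R : realType) (n : nat) (a b : nat -> R)
    (ak bk : nat -> nat -> R) (c : R) (ck : nat -> R) :
  (forall i, a i <= b i) -> (forall k i, ak k i <= bk k i) ->
  0 <= c -> (forall k, 0 <= ck k) ->
  (forall x : nat -> R, (c * \prod_(i < n) \1_(`[a i, b i]%classic) (x i))%:E <=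
     \sum_(0 <= k <oo)
        (ck k * \prod_(i < n) \1_(`[ak k i, bk k i]%classic) (x i))%:E)%E ->
  ((c * \prod_(i < n) (b i - a i))%:E <=
     \sum_(0 <= k <oo) (ck k * \prod_(i < n) (bk k i - ak k i))%:E)%E.
Proof.
move=> ab abk; elim: n c ck => [|n IH] c ck c0 ck0 h.
  (* In dimension 0 all products are empty, so the hypothesis at any point is the claim. *)
  have := h (fun=> 0); rewrite !big_ord0 => /le_trans; apply.
  rewrite le_eqVlt; apply/orP; left; apply/eqP/eq_eseriesr => k _.
  by rewrite !big_ord0.
have prod_ge0 (a' b' x : nat -> R) :
    0 <= \prod_(i < n) (\1_(`[a' i, b' i]%classic) (x i) : R).
  by apply: prodr_ge0 => i _; rewrite indicE ler0n.
rewrite big_ord_recr/= mulrA mulrAC.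
rewrite (_ : (\sum_(0 <= k <oo) _)%E = (\sum_(0 <= k <oo)
    (ck k * (bk k n - ak k n) * \prod_(i < n) (bk k i - ak k i))%:E)%E); last first.
  by apply: eq_eseriesr => k _; rewrite big_ord_recr/= mulrA mulrAC.
apply: IH => [|k|x].
- by rewrite mulr_ge0// subr_ge0.
- by rewrite mulr_ge0// subr_ge0.
have h' t : ((c * \prod_(i < n) \1_(`[a i, b i]%classic) (x i) *
      \1_(`[a n, b n]%classic) t)%:E <= \sum_(0 <= k <oo)
      (ck k * \prod_(i < n) \1_(`[ak k i, bk k i]%classic) (x i) *
       \1_(`[ak k n, bk k n]%classic) t)%:E)%E.
  have E (a' b' : nat -> R) (c' : R) :
      c' * \prod_(i < n.+1)
        \1_(`[a' i, b' i]%classic) (if (i < n)%N then x i else t) =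
      c' * \prod_(i < n) \1_(`[a' i, b' i]%classic) (x i) *
        \1_(`[a' n, b' n]%classic) t.
    rewrite big_ord_recr/= ltnn mulrA; congr (_ * _ * _).
    by apply: eq_bigr => i _; rewrite ltn_ord.
  have := h (fun i => if (i < n)%N then x i else t); rewrite E.
  move=> /le_trans; apply.
  by rewrite le_eqVlt; apply/orP; left; apply/eqP/eq_eseriesr => k _; rewrite E.
rewrite mulrAC -integral_indic_itv ?mulr_ge0//.
rewrite (_ : (\sum_(0 <= k <oo) _)%E = (\sum_(0 <= k <oo)
    \int[lebesgue_measure]_t
      (ck k * \prod_(i < n) \1_(`[ak k i, bk k i]%classic) (x i) *
       \1_(`[ak k n, bk k n]%classic) t)%:E)%E); last first.
  by apply: eq_eseriesr => k _; rewrite mulrAC integral_indic_itv ?mulr_ge0.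
have mind (r a' b' : R) :
    measurable_fun setT (fun t : R => (r * \1_(`[a', b']%classic) t)%:E).
  apply/measurable_EFinP/measurable_funM => //; exact: measurable_indic.
have term_ge0 (r a' b' t : R) : 0 <= r ->
    (0 <= (r * \1_(`[a', b']%classic) t)%:E)%E.
  by move=> r0; rewrite lee_fin mulr_ge0// indicE ler0n.
(* Nonnegativity of the terms allows the integral over the last coordinate to be exchanged with the
   series. *)
rewrite -integral_nneseries//; [|by move=> k; exact: mind|]; last first.
  by move=> k t _; apply: term_ge0; rewrite mulr_ge0.
apply: ge0_le_integral => //.
- by move=> t _; apply: term_ge0; rewrite mulr_ge0.
- exact: mind.
- apply: ge0_emeasurable_sum => [k t _ _|k _]; last exact: mind.
  by apply: term_ge0; rewrite mulr_ge0.
Qed.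

(** A cover is an inequality between the indicator of the box and the sum of the indicators of the
    covering boxes; all weights are 1. *)
Lemma box_cover_volume (R : realType) (N : nat) (a b : 'rV[R]_N)
    (ak bk : nat -> 'rV[R]_N) :
  (forall i, a 0 i <= b 0 i) -> (forall k i, ak k 0 i <= bk k 0 i) ->
  [set x : 'rV[R]_N | forall i, a 0 i <= x 0 i <= b 0 i] `<=`
    \bigcup_k [set x : 'rV[R]_N | forall i, ak k 0 i <= x 0 i <= bk k 0 i] ->
  ((\prod_(i < N) (b 0 i - a 0 i))%:E <=
     \sum_(0 <= k <oo) (\prod_(i < N) (bk k 0 i - ak k 0 i))%:E)%E.
Proof.
move=> ab abk cover.
(* Row vectors become sequences, extended by 0, to match the dimension-free indexing of the
   induction. *)
pose ext (v : 'rV[R]_N) (i : nat) : R := if insub i is Some j then v 0 j else 0.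
have extE (v : 'rV[R]_N) (i : 'I_N) : ext v i = v 0 i by rewrite /ext valK.
have ext_le (v w : 'rV[R]_N) : (forall i : 'I_N, v 0 i <= w 0 i) ->
    forall i : nat, ext v i <= ext w i.
  by move=> vw i; rewrite /ext; case: insubP.
have ind01 (v w : 'rV[R]_N) (x : nat -> R) :
    \prod_(i < N) \1_(`[ext v i, ext w i]%classic) (x i) =
    (`[< forall i : 'I_N, v 0 i <= x i <= w 0 i >])%:R :> R.
  case: asboolP => [vxw|].
    apply: big1 => i _; rewrite indicE mem_set//= in_itv/= !extE.
    exact: vxw.
  move=> /existsNP[i /negP vxw]; rewrite (bigD1 i)//= indicE memNset ?mul0r//=.
  by rewrite in_itv/= !extE; exact/negP.
have := @weighted_box_cover R N (ext a) (ext b) (fun k => ext (ak k))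
  (fun k => ext (bk k)) 1 (fun=> 1) (ext_le _ _ ab) (fun k => ext_le _ _ (abk k))
  ler01 (fun=> ler01).
rewrite mul1r (eq_bigr (fun i => b 0 i - a 0 i)); last by move=> i _; rewrite !extE.
rewrite (_ : (\sum_(0 <= k <oo) (1 * \prod_(i < N) _)%:E)%E =
  (\sum_(0 <= k <oo) (\prod_(i < N) (bk k 0 i - ak k 0 i))%:E)%E); last first.
  apply: eq_eseriesr => k _; rewrite mul1r; congr EFin.
  by apply: eq_bigr => i _; rewrite !extE.
apply=> x; rewrite mul1r ind01.
have t0 k : (0 <= (1 * \prod_(i < N)
    \1_(`[ext (ak k) i, ext (bk k) i]%classic) (x i) : R)%:E)%E.
  by rewrite mul1r ind01 lee_fin ler0n.
case: asboolP => [axb|_]; last by apply: nneseries_ge0 => k _ _; exact: t0.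
have [|k _ /= xk] := cover (\row_i x i); first by move=> i; rewrite mxE.
rewrite (@nneseriesD1 _ _ k xpredT (fun k _ => t0 k) isT).
rewrite mul1r ind01 asboolT; last by move=> i; have := xk i; rewrite mxE.
by rewrite leeDl// nneseries_ge0// => *; exact: t0.
Qed.

(** The neighbourhood contains a cube of side [e], which boxes of half its volume cannot cover. *)
Lemma nbhs_not_lebesgue_null (R : realType) (N : nat) (A : set 'rV[R]_N)
    (x : 'rV[R]_N) : nbhs x A -> ~ lebesgue_null A.
Proof.
move=> /nbhs_ballP[e /= e0 eA] A0.
have v0 : 0 < e ^+ N by rewrite exprn_gt0.
have [ak [bk [abk cover vol]]] := A0 (e ^+ N / 2) (divr_gt0 v0 (ltr0Sn _ 1)).
pose h := const_mx (e / 2) : 'rV[R]_N.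
have := @box_cover_volume R N (x - h) (x + h) ak bk.
rewrite (eq_bigr (fun=> e)); last by move=> i _; rewrite !mxE; field.
rewrite prodr_const card_ord => /(_ _ abk _)/le_trans/(_ vol).
rewrite lee_fin => H.
suff : e ^+ N <= e ^+ N / 2 by rewrite ler_pdivlMr// ger_pMr// lern1.
apply: H => [i|y xy]; first by rewrite !mxE; lra.
apply: cover; apply: eA; rewrite -ball_normE/=.
apply: (@le_lt_trans _ _ (e / 2)); last by lra.
apply: norm_le_coord => [|i]; first by lra.
by have := xy i; rewrite !mxE ler_norml => /andP[? ?]; apply/andP; split; lra.
Qed.

(** * Solutions and the strong maximum principle *)

(** The two semicontinuities give continuity; the exterior inequalities then pass to the boundary,
    so [u = g] off [Omega] and both extensions collapse to [u]. *)
Lemma viscosity_solution_facts (p : problem) (R : realType) (N : nat) (s : R)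
    (Omega : set 'rV[R]_N) (g u : 'rV[R]_N -> R) :
  open Omega -> C2_boundary Omega -> exterior_datum Omega g ->
  viscosity_solution p s Omega g u ->
  [/\ continuous u, forall x, (~` Omega) x -> u x = g x,
      interior_subsolution p s Omega u & interior_supersolution p s Omega u].
Proof.
move=> oO bO [cg _] [[_ us ug sub] [_ ls gu super]].
have cu : continuous u by exact: semicontinuous_continuous.
have uE x : (~` Omega) x -> u x = g x.
  have cu' : {within ~` Omega, continuous u} by exact: continuous_subspaceT.
  move=> Ox; apply/eqP; rewrite eq_le -subr_le0 -[g x <= _]subr_le0.
  apply/andP; split.
  - apply: (@le_on_complement _ _ Omega (u \- g)) => // y.
      by apply: continuousB; [exact: cu'|exact: cg].
    by move=> /ug; rewrite /= subr_le0.
  - apply: (@le_on_complement _ _ Omega (g \- u)) => // y.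
      by apply: continuousB; [exact: cg|exact: cu'].
    by move=> /gu; rewrite /= subr_le0.
split=> //.
- move=> d phi x0 d0 phi2 ux0 Ox0; rewrite -(upper_ext_id uE).
  exact: (proj1 (sub d phi x0 d0 phi2 ux0)).
- move=> d phi x0 d0 phi2 ux0 Ox0; rewrite -(lower_ext_id uE).
  exact: (proj1 (super d phi x0 d0 phi2 ux0)).
Qed.

Lemma bounded_funW (R : realType) (T : Type) (u : T -> R) :
  bounded_fun u -> exists C, forall x, `|u x| <= C.
Proof.
by move=> [M [_ uM]]; exists (M + 1) => x; apply: uM => //; rewrite ltrDl.
Qed.

Lemma continuous_levy_kernel (R : realType) (s r : R) : 0 < r ->
  {for r, continuous (levy_kernel s)}.
Proof.
move=> r0; apply: (@continuous_comp _ _ _ (@Num.norm _ R) (fun t => t `^ _)).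
  exact: norm_continuous.
by apply: powR_continuous_gt0; rewrite normr_gt0 gt_eqF.
Qed.

(** A positive value at [r] would keep [f] above [f r / 2] on an interval, making the integral of
    this nonnegative function positive. *)
Lemma Rintegral_eq0_continuous (R : realType) (d r : R) (f : R -> R) :
  d <= r ->
  lebesgue_measure.-integrable [set t : R | d <= `|t|] (EFin \o f) ->
  (forall t, d <= `|t| -> 0 <= f t) -> {for r, continuous f} ->
  \int[lebesgue_measure]_(t in [set t : R | d <= `|t|]) f t = 0 -> f r <= 0.
Proof.
move=> dr fint f0 cf If; rewrite leNgt; apply/negP => fr.
have /nbhs_ballP[e /= e0 fe] : nbhs r [set t | f r / 2 < f t].
  apply: (cf [set t | f r / 2 < t]); apply: open_nbhs_nbhs; split.
    exact: open_gt.
  by rewrite /= ltr_pdivrMr// ltr_pMr// ltr1n.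
(* An interval to the right of [r] remains in the domain even when [r = d]. *)
pose B := `[r, (r + e / 2)]%classic.
have BA : B `<=` [set t : R | d <= `|t|].
  move=> t; rewrite /B/= in_itv/= => /andP[rt _].
  by rewrite (le_trans dr)// (le_trans rt)// ler_norm.
have mB : measurable B by exact: measurable_itv.
have := measurable_int _ fint => mf.
have IE : (\int[lebesgue_measure]_(t in [set t : R | (d <= `|t|)%R])
    (f t)%:E = 0)%E.
  have /fineK <- : (\int[lebesgue_measure]_(t in [set t : R | (d <= `|t|)%R])
      (f t)%:E \is a fin_num)%E.
    by apply: integrable_fin_num; [exact: measurable_abs_ge|exact: fint].
  by congr EFin.
have : ((f r / 2 * (e / 2))%:E <= 0 :> \bar R)%E.
  rewrite -IE.
  apply: (@le_trans _ _ (\int[lebesgue_measure]_(t in B) (f t)%:E)%E).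
    apply: (@le_trans _ _ (\int[lebesgue_measure]_(t in B) (f r / 2)%:E)%E).
      rewrite integral_cst//= lebesgue_measure_itv/= lte_fin ltrDl divr_gt0//.
      by rewrite -EFinB -EFinM addrC addKr.
    apply: ge0_le_integral => //.
    - by move=> t _; rewrite lee_fin divr_ge0// ltW.
    - by apply: (measurable_funS _ BA) mf; exact: measurable_abs_ge.
    - move=> t; rewrite /B/= in_itv/= => /andP[rt te].
      rewrite lee_fin ltW//; apply: fe; rewrite -ball_normE/= ltr_norml.
      by apply/andP; split; lra.
  by apply: ge0_subset_integral => //; exact: measurable_abs_ge.
by rewrite lee_fin leNgt mulr_gt0// divr_gt0.
Qed.

(** A global maximum is touched by a constant, so each directional operator reduces to a tail
    integral of nonpositive increments. The equation makes these integrals vanish, and the line from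
    [x0] towards [x] gives the value at [x]. *)
Lemma strong_maximum (p : problem) (R : realType) (N : nat) (s C : R)
    (Omega : set 'rV[R]_N) (u : 'rV[R]_N -> R) (x0 : 'rV[R]_N) :
  (0 < N)%N -> 0 < s -> s < 1 -> continuous u -> (forall x, `|u x| <= C) ->
  interior_subsolution p s Omega u -> Omega x0 -> (forall x, u x <= u x0) ->
  forall x, u x = u x0.
Proof.
move=> N0 s0 s1 cu uC sub Ox0 umax x.
have [->//|xx0] := eqVneq x x0.
pose r := enorm (x - x0).
have r0 : 0 < r.
  rewrite lt_def sqrtr_ge0 andbT; apply: contra_neq xx0 => /enorm_eq0 /eqP.
  by rewrite subr_eq0 => /eqP.
pose z := r^-1 *: (x - x0).
have z1 : enorm z = 1 by rewrite enormZ gtr0_norm ?invr_gt0// mulVf ?gt_eqF.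
have xE : x0 + r *: z = x by rewrite scalerA divff ?gt_eqF// scale1r subrKC.
(* Any [d] up to [r] places the parameter [r] of the point [x] in the tail. *)
pose d := r / 2; have d0 : 0 < d by rewrite divr_gt0.
have := sub d (paraboloid 0 0 x0) x0 d0 (C2_paraboloid _ _ _) _ Ox0.
rewrite E_problemE => Eu.
have [K EK] := E_dir_bounded 0 0 x0 x0 s0 s1 d0 cu uC.
have Eint z' : enorm z' = 1 -> E_dir s z' d u (paraboloid 0 0 x0) x0 =
    - \int[lebesgue_measure]_(t in [set t : R | d <= `|t|])
        - frac_quotient s z' u x0 t.
  move=> z'1; rewrite E_dir_paraboloid// mul0r add0r.
  under [in RHS]eq_Rintegral do rewrite -mulN1r.
  rewrite RintegralZl ?mulN1r ?opprK//; first exact: measurable_abs_ge.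
  exact: integrable_frac_quotient uC.
have fq0 z' t : 0 <= - frac_quotient s z' u x0 t.
  rewrite frac_quotientE -mulNr mulr_ge0 ?levy_kernel_ge0//.
  by rewrite oppr_ge0 subr_le0.
have E0 : E_dir s z d u (paraboloid 0 0 x0) x0 = 0.
  apply: (@problem_op_le0 p R N K _ N0 EK _ _ z z1) => [z' z'1|].
    by rewrite Eint// oppr_le0 Rintegral_ge0// => t _; exact: fq0.
  apply: Eu => y _; rewrite /paraboloid !mul0r !addr0 !subr0.
  exact: umax.
have : - frac_quotient s z u x0 r <= 0.
  apply: (@Rintegral_eq0_continuous R d r (fun t => - frac_quotient s z u x0 t)).
  - by rewrite ler_pdivrMr// ler_pMr// ler1n.
  - have := integrable_EFinZl (-1) (measurable_abs_ge d)
      (integrable_frac_quotient x0 z s0 d0 cu uC).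
    apply: eq_integrable => [|t _ /=]; last by rewrite mulN1r.
    exact: measurable_abs_ge.
  - by move=> t _; exact: fq0.
  - rewrite (_ : (fun t => _) =
        (fun t => - (u (x0 + t *: z) - u x0) * levy_kernel s t)); last first.
      by apply/funext => t; rewrite frac_quotientE mulNr.
    apply: cvgM; last exact: continuous_levy_kernel.
    apply: cvgN; apply: cvgB; last exact: cvg_cst.
    by apply: (@continuous_comp _ _ _ (fun t : R => x0 + t *: z) u);
      [exact: continuous_line|exact: cu].
  - by apply/eqP; rewrite -oppr_eq0 -Eint// E0.
rewrite frac_quotientE xE oppr_le0 pmulr_lge0 ?levy_kernel_gt0 ?gt_eqF//.
by rewrite subr_ge0 => h; apply/eqP; rewrite eq_le umax.
Qed.

(** * Assembly of the three assertions for viscosity solutions *)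

(** Boxes reduced to a point have volume 0 as soon as there is one side; in dimension 0 the empty
    product would be 1. *)
Lemma lebesgue_null_set0 (R : realType) (N : nat) : (0 < N)%N ->
  lebesgue_null (set0 : set 'rV[R]_N).
Proof.
move=> N0 e e0; exists (fun=> 0), (fun=> 0); split=> //.
rewrite eseries0 ?lee_fin ?ltW// => k _ _.
by rewrite (bigD1 (Ordinal N0))//= mxE subrr mul0r.
Qed.

Theorem theorem1p2 (R : realType) (N : nat) (hN : (0 < N)%N)
    (s : R) (hs : 1 / 2 < s < 1)
    (Omega : set 'rV[R]_N) (hOmega : bounded_C2_domain Omega)
    (p : problem) :
  [/\ forall g1 g2 u1 u2 : 'rV[R]_N -> R,
        exterior_datum Omega g1 -> exterior_datum Omega g2 ->
        viscosity_solution p s Omega g1 u1 ->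
        viscosity_solution p s Omega g2 u2 ->
        (forall x, (~` Omega) x -> g2 x <= g1 x) ->
        forall x, Omega x -> u2 x <= u1 x,
      forall g1 g2 u1 u2 : 'rV[R]_N -> R,
        exterior_datum Omega g1 -> exterior_datum Omega g2 ->
        viscosity_solution p s Omega g1 u1 ->
        viscosity_solution p s Omega g2 u2 ->
        (Linfty_norm Omega (fun x => (u1 x - u2 x)%R)
           <= Linfty_norm (~` Omega) (fun x => (g1 x - g2 x)%R))%E &
      forall g u : 'rV[R]_N -> R,
        exterior_datum Omega g ->
        viscosity_solution p s Omega g u ->
        (exists2 x0, Omega x0 & sup [set g y | y in ~` Omega] <= u x0) ->
        exists c : R,
          (forall x, u x = c) /\ (forall x, (~` Omega) x -> g x = c)].
Proof.
move: hs => /andP[s12 s1].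
have s0 : 0 < s by rewrite (lt_trans _ s12)// divr_gt0.
have [_ oO _ bdO bO] := hOmega.
have compare g1 g2 u1 u2 M :
    exterior_datum Omega g1 -> exterior_datum Omega g2 ->
    viscosity_solution p s Omega g1 u1 -> viscosity_solution p s Omega g2 u2 ->
    (forall x, (~` Omega) x -> g2 x <= g1 x + M) ->
    forall x, Omega x -> u2 x <= u1 x + M.
  move=> dg1 dg2 vs1 vs2 g21.
  have [cu1 u1E _ sup1] := viscosity_solution_facts oO bO dg1 vs1.
  have [cu2 u2E sub2 _] := viscosity_solution_facts oO bO dg2 vs2.
  have [[/bounded_funW[B1 u1C] _ _ _] _] := vs1.
  have [[/bounded_funW[B2 u2C] _ _ _] _] := vs2.
  apply: (@comparison_interior R N p s (Num.max B1 B2) M Omega u1 u2) => //.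
  - by move=> x; rewrite le_max u1C.
  - by move=> x; rewrite le_max u2C orbT.
  - by move=> x Ox; rewrite u1E// u2E//; exact: g21.
split.
- move=> g1 g2 u1 u2 dg1 dg2 vs1 vs2 g21 x Ox.
  rewrite -[leRHS]addr0; apply: (compare g1 g2 u1 u2 0) => // y Oy.
  by rewrite addr0; exact: g21.
- move=> g1 g2 u1 u2 dg1 dg2 vs1 vs2.
  have [cu1 u1E _ _] := viscosity_solution_facts oO bO dg1 vs1.
  have [cu2 u2E _ _] := viscosity_solution_facts oO bO dg2 vs2.
  (* Every essential bound [M] for the data is shown to be a pointwise bound for the solutions, so
     the exceptional set is empty. *)
  apply: le_ereal_inf_tmp => _ [M [M0 Mnull] <-].
  apply: ereal_inf_lbound; exists M => //; split=> //.
  rewrite (_ : [set _ | _] = set0); first exact: lebesgue_null_set0.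
  have cd : continuous (fun x => `|u1 x - u2 x|).
    move=> x; apply: (@continuous_comp _ _ _ (fun x => u1 x - u2 x)
      (@Num.norm _ R)); last exact: norm_continuous.
    by apply: (cvgB (FF := nbhs_filter x)); [exact: cu1|exact: cu2].
  (* The essential bound holds everywhere off [Omega]: a violation at an exterior point would fill
     an open set, which is not null, and boundary points are limits of exterior ones. *)
  have gM x : (~` Omega) x -> `|g1 x - g2 x| <= M.
    move=> Ox; rewrite -u1E// -u2E//.
    apply: (@le_on_complement _ _ Omega (fun x => `|u1 x - u2 x|)) => // {x Ox}.
      exact: continuous_subspaceT.
    move=> x xO; rewrite leNgt; apply/negP => Mx.
    apply: (@nbhs_not_lebesgue_null _ _ _ x _ Mnull).
    have : nbhs x (~` closure Omega `&`
        (fun x => `|u1 x - u2 x|) @^-1` [set t | M < t]).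
      apply: open_nbhs_nbhs; split; last by split.
      apply: openI; first exact/closed_openC/closed_closure.
      by apply: open_comp; [move=> y _; exact: cd|exact: open_gt].
    apply: filterS => y [yO My].
    have nOy : (~` Omega) y by move=> /(@subset_closure _ Omega).
    by split=> //; rewrite -u1E// -u2E.
  apply/seteqP; split=> // x [Ox]; rewrite ltNge => /negP; apply.
  have h1 : u2 x <= u1 x + M.
    apply: (compare g1 g2 u1 u2 M) => // y /gM.
    by rewrite ler_norml => /andP[? ?]; lra.
  have h2 : u1 x <= u2 x + M.
    apply: (compare g2 g1 u2 u1 M) => // y /gM.
    by rewrite ler_norml => /andP[? ?]; lra.
  by rewrite ler_norml; apply/andP; split; lra.
- move=> g u dg vs [x0 Ox0 gx0].
  have [cu uE sub _] := viscosity_solution_facts oO bO dg vs.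
  have [[/bounded_funW[C uC] _ _ _] _] := vs.
  (* The datum inherits the bound of [u], so [sup] is the actual supremum. *)
  have ux0 x : (~` Omega) x -> u x <= u x0.
    move=> Ox; rewrite (le_trans _ gx0)// uE//.
    apply: ub_le_sup; last by exists x.
    exists C => _ [y Oy <-]; rewrite -uE//.
    exact: le_trans (ler_norm _) (uC y).
  have [r0 [_ Or]] := bdO.
  pose K := [set x : 'rV[R]_N | `|x| <= r0 + 1].
  have OK x : Omega x -> K x by apply: Or; rewrite ltrDl.
  have cK : compact K by exact: compact_norm_le.
  have [y _ ymax] := compact_EVT_max (ex_intro _ _ (OK _ Ox0)) cK
    (continuous_subspaceT cu).
  have {}ymax x : K x -> u x <= u y by move=> Kx; apply: ymax; rewrite inE.
  (* If the maximum over [K] is attained at a point outside [Omega], its value is at most [u x0], so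
     [x0] itself is a global maximum point. *)
  have [x1 Ox1 x1max] : exists2 x1, Omega x1 & forall x, u x <= u x1.
    have [Oy|nOy] := pselect (Omega y).
      exists y => // x; have [/OK/ymax//|nOx] := pselect (Omega x).
      exact: le_trans (ux0 _ nOx) (ymax _ (OK _ Ox0)).
    exists x0 => // x; have [/OK/ymax h|/ux0//] := pselect (Omega x).
    exact: le_trans h (ux0 _ nOy).
  have uc := strong_maximum hN s0 s1 cu uC sub Ox1 x1max.
  by exists (u x1); split=> // x Ox; rewrite -uE.
Qed.
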